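(* For every $C,J,\varepsilon,\delta>0$, there exist $\lambda,q,M>0$, such that for every $\zeta>0$, there exists $\beta>0$ such that for every $\gamma>0$ there exists $\rho>0$ such that for every sufficiently large $d$ and every graph $G$, there is an edge-decomposition of $G$ into $G_0,G_1,G_2,G_3,G_4$ satisfying the following properties. \begin{itemize} \item (Exceptional edges) The graph $G_0$ contains at most $\varepsilon e(G)$ edges. \item (Small vertex-cover) Every connected component of $G_1$ has a vertex-cover of size at most $Cd$. \item (Large regular cores) $G_2$ is the union of edge-disjoint $\rho$-cut-dense graphs $H$, each of which contains a $qd$-regular subgraph of order at least $Cd$ and satisfies $|V(H)|\leq Md$. \item (Nowhere dense) $G_3$ does not contain a set of at most $Jd$ vertices inducing at least $\delta d^2$ edges. \item (Well-connected pieces) $G_4$ is the edge-disjoint union of a collection $\mathcal H$ of graphs satisfying the following properties. \begin{enumerate} \item Each $H\in\mathcal H$ contains a subgraph $Q$ of size at least $\beta d$ which is $\beta$-cut-dense, and every vertex in $V(H)\setminus V(Q)$ has at least $\beta d$ neighbors (in $H$) in $V(Q)$. \item Any two distinct $H,H'\in\mathcal H$ intersect in at most $\zeta d$ vertices. \item Every $H\in\mathcal H$ has at least $\lambda d$ vertices each of which belongs to some other $H'\in\mathcal H$. \item For every $H\in\mathcal H$ there are at most $1/\lambda$ other $H'\in\mathcal H$ which intersect $H$ in more than $\gamma d$ vertices. \end{enumerate} \end{itemize}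
   Context: All graphs are finite and simple; $e(G)$ is the number of edges of $G$. The order or size of a (sub)graph here means its number of vertices. An edge-decomposition of $G$ into $G_0,\dots,G_4$ means that $G_0,\dots,G_4$ are pairwise edge-disjoint subgraphs of $G$ whose edge sets have union $E(G)$; some of them (and the collections describing $G_2$ and $G_4$) may be empty. A graph $H$ is $\rho$-cut-dense if for all partitions $V(H)=A\sqcup B$ we have $e_H(A,B)\geq\rho|A||B|$, where $e_H(A,B)$ is the number of edges of $H$ between $A$ and $B$. A vertex-cover is a set of vertices meeting every edge. Two graphs intersect in $k$ vertices if $|V(H)\cap V(H')|=k$. Floor and ceiling signs are omitted (e.g. $qd$ is treated as an integer). *)

(* Defs.v *)
From HB Require Import structures.
From mathcomp Require Import all_boot all_order all_algebra.
From mathcomp Require Import reals.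
Set Implicit Arguments.
Unset Strict Implicit.
Unset Printing Implicit Defensive.
Import Order.TTheory GRing.Theory Num.Theory.

Local Open Scope ring_scope.

(* A finite simple graph with vertices in [T]: a vertex set, not necessarily
   all of [T] and possibly empty, and a set of two-element subsets of it. *)
Definition is_graph (T : finType) (p : {set T} * {set {set T}}) : bool :=
  [forall e in p.2, (e \subset p.1) && (#|e| == 2)].

Record graph (T : finType) := Graph {
  graph_val :> {set T} * {set {set T}};
  _ : is_graph graph_val }.

HB.instance Definition _ (T : finType) := [isSub for @graph_val T].
HB.instance Definition _ (T : finType) := [Finite of graph T by <:].

Definition verts (T : finType) (G : graph T) : {set T} := (graph_val G).1.

Definition edges (T : finType) (G : graph T) : {set {set T}} := (graph_val G).2.

Definition adj (T : finType) (G : graph T) : rel T :=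
  fun x y => [set x; y] \in edges G.

Definition subgraph (T : finType) (H G : graph T) : bool :=
  (verts H \subset verts G) && (edges H \subset edges G).

Definition edge_disjoint (T : finType) (G H : graph T) : bool :=
  [disjoint edges G & edges H].

Definition neighbors (T : finType) (G : graph T) (v : T) : {set T} :=
  [set w in verts G | adj G v w].

Fact induced_is_graph (T : finType) (G : graph T) (S : {set T}) :
  is_graph (verts G :&: S, [set e in edges G | e \subset S]).
Proof.
apply/forallP=> e; apply/implyP; rewrite !inE /= => /andP[eG eS].
have /forallP/(_ e)/implyP/(_ eG)/andP[eV e2] := valP G.
by rewrite subsetI eV eS e2.
Qed.

Definition induced (T : finType) (G : graph T) (S : {set T}) : graph T :=
  Graph (induced_is_graph G S).

Definition components (T : finType) (G : graph T) : {set graph T} :=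
  [set induced G [set y | connect (adj G) x y] | x in verts G].

Definition vertex_cover (T : finType) (G : graph T) (S : {set T}) : bool :=
  (S \subset verts G) && [forall e in edges G, e :&: S != set0].

Definition regular (T : finType) (r : nat) (G : graph T) : bool :=
  [forall v in verts G, #|neighbors G v| == r].

(* Meant for disjoint [A] and [B], where each edge is counted once. *)
Definition edges_between (T : finType) (G : graph T) (A B : {set T}) : nat :=
  #|[set p in setX A B | adj G p.1 p.2]|.

Definition cut_dense (R : realType) (T : finType) (rho : R) (G : graph T) :
    Prop :=
  forall A B : {set T}, A :|: B = verts G -> [disjoint A & B] ->
    rho * #|A|%:R * #|B|%:R <= (edges_between G A B)%:R.

Definition edge_decomposition (T : finType) (G : graph T)
    (s : seq (graph T)) : Prop :=
  [/\ all (fun H => subgraph H G) s,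
      pairwise (@edge_disjoint T) s
    & \bigcup_(H <- s) edges H = edges G].

Definition edge_disjoint_union (T : finType) (G : graph T)
    (HH : {set graph T}) : Prop :=
  [/\ verts G = \bigcup_(H in HH) verts H,
      edges G = \bigcup_(H in HH) edges H
    & {in HH &, forall H H', H != H' -> edge_disjoint H H'}].

Definition common_verts (T : finType) (G H : graph T) : {set T} :=
  verts G :&: verts H.

Definition small_vertex_cover (R : realType) (T : finType) (C : R) (d : nat)
    (G : graph T) : Prop :=
  forall K, K \in components G ->
    exists2 S : {set T}, vertex_cover K S & #|S|%:R <= C * d%:R.

(* The degree [q * d] is rounded down to a natural number. *)
Definition large_regular_cores (R : realType) (T : finType) (C q M rho : R)
    (d : nat) (G : graph T) : Prop :=
  exists2 HH : {set graph T}, edge_disjoint_union G HH &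
    forall H, H \in HH ->
      [/\ cut_dense rho H,
          exists K : graph T,
            [/\ subgraph K H, regular (Num.truncn (q * d%:R)) K
              & C * d%:R <= #|verts K|%:R]
        & #|verts H|%:R <= M * d%:R].

Definition nowhere_dense (R : realType) (T : finType) (J delta : R) (d : nat)
    (G : graph T) : Prop :=
  ~ exists S : {set T},
      [/\ S \subset verts G, #|S|%:R <= J * d%:R
        & delta * d%:R ^+ 2 <= #|edges (induced G S)|%:R].

Definition well_connected_pieces (R : realType) (T : finType)
    (lambda zeta beta gamma : R) (d : nat) (G : graph T) : Prop :=
  exists2 HH : {set graph T}, edge_disjoint_union G HH &
    [/\ forall H, H \in HH ->
          exists Q : graph T,
            [/\ subgraph Q H, beta * d%:R <= #|verts Q|%:R, cut_dense beta Q
              & forall v, v \in verts H :\: verts Q ->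
                  beta * d%:R <= #|neighbors H v :&: verts Q|%:R],
        forall H H', H \in HH -> H' \in HH -> H != H' ->
          #|common_verts H H'|%:R <= zeta * d%:R,
        forall H, H \in HH ->
          lambda * d%:R
          <= #|[set v in verts H |
                 [exists H' in HH, (H' != H) && (v \in verts H')]]|%:R
      & forall H, H \in HH ->
          #|[set H' in HH | (H' != H)
              && (gamma * d%:R < #|common_verts H H'|%:R)]|%:R <= 1 / lambda].

(* Main.v *)
(** Remove from [G] a maximal family of edge-disjoint large regular cores; this
    is [G2], and the rest contains no cut-dense graph on [M d] vertices with a
    [q d]-regular subgraph of order [C d]. In the rest take a maximal family of
    edge-disjoint atoms: dense quasirandom bipartite graphs on [Theta(d)]
    vertices, which exist wherever there are many edges on few vertices, so
    that the remaining edges form [G3]. An atom minus a set [W] contains a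
    [q d]-regular subgraph unless one side of it is nearly inside [W].

    Merge the atoms into clusters until distinct clusters meet in at most
    [zeta d] vertices. A merger either produces a larger regular subgraph in
    the bounded cut-dense core of the cluster, which happens boundedly often as
    there is no large regular core, or it leaves the core unchanged. A cluster
    which meets many others in more than [gamma d] vertices would
    again give a large regular core: the cores of these others are almost
    disjoint and contribute their own regular subgraphs.

    Finally, repeatedly take out a cluster with fewer than [lambda d] vertices
    in the other remaining clusters. Deleting its edges at those vertices makes
    it disjoint from them, and the vertex set [W] of a maximal regular subgraph
    of its core, which has at most [C d] vertices, covers almost all its edges;
    these form [G1]. The remaining clusters form [G4]. *)
From HB Require Import structures.
Require Import Defs.
From mathcomp Require Import all_boot all_order all_algebra.
From mathcomp Require Import boolp reals.
From mathcomp Require Import zify ring lra.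
Set Implicit Arguments.
Unset Strict Implicit.
Unset Printing Implicit Defensive.
Import Order.TTheory GRing.Theory Num.Theory.

Local Open Scope ring_scope.

(** * Counting pairs *)

Section Counting.
Variable T : finType.
Implicit Types (r : rel T) (A B S X Y Z W : {set T}).

(** The order of the constants shapes the argument. [lambda], [q] and [M] precede [zeta], so cores
    must be bounded without reference to the overlap at which clusters merge, although a cluster may
    absorb arbitrarily many atoms. Levels achieve this: each rise adds [q * d] vertices to a regular
    graph in the core, order [C * d] is impossible, so there are about [C / q] levels, and the bound
    on the core triples per level whatever [zeta] is. Only cut-density pays for [zeta], and [beta]
    may depend on it; [gamma] enters only when many clusters are joined to refute property 4, at the
    expense of [rho].

    A core is kept apart from its hull, which adds every vertex with [alpha * d] neighbours in the
    core. The core stays bounded and cut-dense; the hull may be arbitrarily large and becomes the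
    vertex set of the final piece. An overlap of hulls suffices for merging, because the common
    vertices attach to both cores.

    The scale of an atom is a small fraction of its sides, so deleting the edges at about that many
    vertices costs at most a fraction [epsilon] of the atom. All of [G0] arises in this way. *)

Definition degree r x B := #|[set y in B | r x y]|.

Definition npairs r A B := #|[set p in setX A B | r p.1 p.2]|.

Lemma npairsE r A B : npairs r A B = (\sum_(x in A) degree r x B)%N.
Proof.
rewrite /npairs -sum1_card.
under eq_bigl => p do rewrite !inE -andbA.
rewrite -(pair_big_dep (fun x => x \in A) (fun x y => (y \in B) && r x y)
  (fun _ _ => 1%N)) /=.
by apply: eq_bigr => x _; rewrite sum1dep_card.
Qed.

Lemma degreeS r x A B : A \subset B -> (degree r x A <= degree r x B)%N.
Proof.
move=> /subsetP sAB; apply/subset_leq_card/subsetP => y; rewrite !inE.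
by case/andP=> /sAB -> ->.
Qed.

Lemma degree_le r x A : (degree r x A <= #|A|)%N.
Proof. by apply/subset_leq_card/subsetP => y; rewrite inE => /andP[]. Qed.

Lemma degreeD r x A B : (degree r x A <= degree r x B + #|A :\: B|)%N.
Proof.
apply: leq_trans (leq_card_setU _ _); apply/subset_leq_card/subsetP => y.
by rewrite !inE => /andP[-> ->]; case: (y \in B).
Qed.

Lemma npairsS r A B A' B' :
  A \subset A' -> B \subset B' -> (npairs r A B <= npairs r A' B')%N.
Proof.
move=> /subsetP sA /subsetP sB; apply/subset_leq_card/subsetP => -[x y].
by rewrite !inE /= => /andP[/andP[/sA-> /sB->] ->].
Qed.

Lemma npairsID r S A B : npairs r A B = (npairs r (A :&: S) B + npairs r (A :\: S) B)%N.
Proof. by rewrite !npairsE (big_setID S). Qed.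

Lemma degreeE r x B : degree r x B = (\sum_(y in B) r x y)%N.
Proof.
rewrite -[RHS]big_mkcondr /= sum1dep_card.
by apply: eq_card => y; rewrite !inE.
Qed.

Lemma npairs_sym r A B : symmetric r -> npairs r A B = npairs r B A.
Proof.
move=> rs; rewrite !npairsE; under eq_bigr do rewrite degreeE.
rewrite exchange_big; apply: eq_bigr => x _; rewrite degreeE.
by apply: eq_bigr => y _; rewrite rs.
Qed.

Lemma npairs_le r A B : (npairs r A B <= #|A| * #|B|)%N.
Proof.
by rewrite -cardsX; apply/subset_leq_card/subsetP => p; rewrite inE => /andP[].
Qed.

Lemma npairs_ge r A B c :
  (forall x, x \in A -> c <= degree r x B)%N -> (#|A| * c <= npairs r A B)%N.
Proof. by move=> h; rewrite npairsE -sum_nat_const leq_sum. Qed.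

Lemma npairs_lt r A B c : (0 < #|A|)%N ->
  (forall x, x \in A -> degree r x B < c)%N -> (npairs r A B < #|A| * c)%N.
Proof.
move=> A0 h; apply: (@leq_trans (npairs r A B + #|A|)).
  by rewrite -[ltnLHS]addn0 ltn_add2l.
rewrite npairsE -sum_nat_const -sum1_card -big_split /= leq_sum // => x /h.
by rewrite addn1.
Qed.

Lemma exists_subset_card A k :
  (k <= #|A|)%N -> exists2 B : {set T}, B \subset A & #|B| = k.
Proof.
elim: k => [|k IHk] kA; first by exists set0; rewrite ?sub0set ?cards0.
have [B sBA Bk] := IHk (ltnW kA).
have /subsetPn[x xA xB] : ~~ (A \subset B).
  by apply: contraTN kA => /subset_leq_card; rewrite Bk -leqNgt.
exists (x |: B); last by rewrite cardsU1 xB Bk.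
by rewrite subUset sub1set xA.
Qed.

(** Deleting an element where [f] is smallest never lowers the average of [f]. *)
Lemma averaging_subset (f : T -> nat) A k : (k <= #|A|)%N ->
  exists B : {set T}, [/\ B \subset A, #|B| = k
    & k * \sum_(x in A) f x <= #|A| * \sum_(x in B) f x]%N.
Proof.
move: {2}(#|A| - k)%N (erefl (#|A| - k)%N) => m.
elim: m A => [|m IHm] A Am kA.
  exists A; split => //; first by lia.
  by rewrite (_ : k = #|A|) //; lia.
have [x0 x0A] : exists x, x \in A by apply/set0Pn; rewrite -card_gt0; lia.
case: (arg_minnP f x0A) => x xA0 xmin; have {xA0} xA : x \in A := xA0.
have cAx : #|A| = #|A :\ x|.+1 by rewrite (cardsD1 x A) xA.
have [||B [sBA Bk avg]] := IHm (A :\ x); try lia.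
exists B; split => //; first by rewrite (subset_trans sBA) // subD1set.
have sx : (\sum_(y in A) f y = f x + \sum_(y in A :\ x) f y)%N.
  by rewrite (big_setD1 x).
have fx : (#|A :\ x| * f x <= \sum_(y in A :\ x) f y)%N.
  by rewrite -sum_nat_const leq_sum // => y /setD1P[_ yA]; exact: xmin.
rewrite cAx sx.
have [c0|cn0] := posnP #|A :\ x|.
  by have -> : k = 0%N by lia.
move: fx avg cn0; move: (f x) (\sum_(y in A :\ x) f y)%N (\sum_(y in B) f y)%N.
move: #|A :\ x| => c u v w fx avg cn0.
rewrite -(leq_pmul2l cn0).
have : (k * (c * u) <= k * v)%N by rewrite leq_mul2l fx orbT.
by nia.
Qed.

Lemma averaging_cnt r A B k : symmetric r -> (k <= #|A|)%N -> (k <= #|B|)%N ->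
  exists A' B', [/\ A' \subset A, B' \subset B, #|A'| = k, #|B'| = k
    & k * k * npairs r A B <= #|A| * #|B| * npairs r A' B']%N.
Proof.
move=> rs kA kB.
have [A' [sA Ak]] := averaging_subset (fun x => degree r x B) kA.
rewrite -!npairsE => avA.
have [B' [sB Bk]] := averaging_subset (fun x => degree r x A') kB.
rewrite -!npairsE (npairs_sym B A') // (npairs_sym B' A') // => avB.
exists A', B'; split=> //.
move: avA avB; move: (npairs r A B) (npairs r A' B) (npairs r A' B') => u v w h1 h2.
rewrite -mulnA (leq_trans (n := k * (#|A| * v))) ?leq_mul2l ?h1 ?orbT //.
by rewrite mulnCA -mulnA leq_mul2l h2 orbT.
Qed.

(** Greedy: each vertex joins the side in which it has fewer neighbours, so at least half of the
    edges cross. The factor is 4 because [npairs r S S] counts every edge twice. *)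
Lemma large_cut r S : symmetric r -> irreflexive r ->
  exists2 A : {set T}, A \subset S & (npairs r S S <= 4 * npairs r A (S :\: A))%N.
Proof.
move=> rs ri; move: {2}#|S| (erefl #|S|) => m.
elim: m S => [|m IHm] S Sm.
  exists set0; rewrite ?sub0set //.
  by move/eqP: Sm; rewrite cards_eq0 => /eqP->; rewrite npairsE big_set0.
have [x xS] : exists x, x \in S by apply/set0Pn; rewrite -card_gt0 Sm.
have cSx : #|S| = #|S :\ x|.+1 by rewrite (cardsD1 x S) xS.
have [|A sA cA] := IHm (S :\ x); first by lia.
set B := (S :\ x) :\: A in cA.
have xA : x \notin A.
  by apply/negP => /(subsetP sA); rewrite !inE eqxx.
have dx : degree r x S = (degree r x A + degree r x B)%N.
  rewrite /degree -cardsUI [X in (_ + X)%N](_ : _ = 0%N) ?addn0; last first.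
    apply/eqP; rewrite cards_eq0; apply/eqP/setP => y; rewrite !inE.
    by case: (y \in A); rewrite ?andbF.
  congr #|pred_of_set _|; apply/setP => y; rewrite !inE.
  have := subsetP sA y; rewrite !inE.
  case: (y \in A) => /= [/(_ isT)/andP[_ ->]|_]; first by rewrite orbF.
  by case: eqP => //= ->; rewrite ri !andbF.
have d1 y : degree r y S = (degree r y (S :\ x) + r x y)%N.
  rewrite addnC {1}/degree (cardsD1 x) inE xS rs /=; congr (_ + _)%N.
  congr #|pred_of_set _|; apply/setP => z; rewrite !inE.
  by case: (z == x).
have cS : (npairs r S S = npairs r (S :\ x) (S :\ x) + 2 * degree r x S)%N.
  rewrite npairsE (big_setD1 x) //= (eq_bigr _ (fun y _ => d1 y)) big_split /=.
  rewrite -npairsE.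
  have -> : (\sum_(y in S :\ x) r x y)%N = degree r x S.
    rewrite -degreeE /degree; apply: eq_card => y; rewrite !inE.
    by case: eqP => // ->; rewrite ri !andbF.
  by lia.
have cUA (C D : {set T}) : x \notin C ->
    (npairs r (x |: C) D = degree r x D + npairs r C D)%N.
  by move=> xC; rewrite !npairsE big_setU1.
have [dAB|dBA] := leqP (degree r x A) (degree r x B).
  exists (x |: A); first by rewrite subUset sub1set xS (subset_trans sA) ?subD1set.
  have -> : S :\: (x |: A) = B.
    by apply/setP => y; rewrite !inE negb_or; case: eqP => //=; rewrite ?andbF.
  by rewrite cUA //; lia.
exists A; first by rewrite (subset_trans sA) ?subD1set.
have -> : S :\: A = x |: B.
  by apply/setP => y; rewrite !inE; case: eqP => //= ->; rewrite xS (negPf xA).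
rewrite npairs_sym // cUA; last by rewrite !inE eqxx andbF.
by rewrite (npairs_sym B) //; lia.
Qed.

End Counting.

(** * Quasirandom pairs in dense graphs *)

Section GoodPairs.
Variables (R : realType) (T : finType).
Implicit Types (r : rel T) (A B S X Y Z W : {set T}).

(* [b] is the scale of quasirandomness; [L] will be of order [1 / epsilon], so
   that the edges at [b] vertices are a negligible part of the pair. *)
Definition good_pair r X Y (L b : nat) (e0 : R) : Prop :=
  [/\ [disjoint X & Y], #|X| = #|Y| /\ (0 < #|X|)%N,
      forall x, x \in X -> (L * b <= degree r x Y)%N,
      forall y, y \in Y -> (L * b <= degree r y X)%N
    & forall A B, A \subset X -> B \subset Y -> (b <= #|A|)%N ->
        (b <= #|B|)%N -> e0 <= (npairs r A B)%:R].

Lemma leq_double_divn m n : (0 < m)%N -> (m <= n)%N -> (n <= 2 * m * (n %/ m))%N.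
Proof.
move=> m0 mn; have q0 : (0 < n %/ m)%N by rewrite divn_gt0.
apply: leq_trans (ltnW (ltn_ceil n m0)) _.
by rewrite mulSn mul2n -addnn mulnDl addnC leq_add // mulnC ?leq_pmull // leq_pmulr.
Qed.

(* Among the balanced pairs of subsets, pass to a pair shrunk by a factor [m]
   whenever its density is larger by a factor [1 + kappa]; as densities are at
   most 1 this stops within [K] steps. *)
Lemma density_increment r (m : nat) : (2 <= m)%N ->
  let kappa : R := (8 * m%:R ^+ 2)^-1 in
  forall K (p : R) n X Y, 0 < p -> #|X| = n -> #|Y| = n ->
  p * n%:R ^+ 2 <= (npairs r X Y)%:R -> 1 < (1 + kappa) ^+ K * p ->
  ((2 * m) ^ K.+1 <= n)%N ->
  exists X' Y' n' p', [/\ X' \subset X, Y' \subset Y, #|X'| = n' /\ #|Y'| = n',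
    (p <= p') /\ (n <= n' * (2 * m) ^ K)%N
  & p' * n'%:R ^+ 2 <= (npairs r X' Y')%:R /\
    forall A B, A \subset X' -> B \subset Y' -> #|A| = (n' %/ m)%N ->
    #|B| = (n' %/ m)%N ->
    (npairs r A B)%:R <= (1 + kappa) * p' * (n' %/ m)%:R ^+ 2].
Proof.
move=> m2 kappa.
have k0 : 0 < kappa by rewrite invr_gt0 mulr_gt0 ?exprn_gt0 ?ltr0n //; lia.
elim=> [|K IHK] p n X Y p0 Xn Yn pn pK nK.
  (* With no step left, the hypothesis says that [p] exceeds 1, while a density is at most 1. *)
  exfalso; have := npairs_le r X Y; rewrite Xn Yn -(ler_nat R) natrM => h.
  have n0 : 0 < n%:R :> R by rewrite ltr0n; lia.
  have : n%:R ^+ 2 < p * n%:R ^+ 2 by rewrite ltr_pMl ?exprn_gt0 // -[p]mul1r.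
  rewrite expr2; rewrite expr2 in pn.
  by move=> /(lt_le_trans)/(_ pn)/lt_le_trans/(_ h); rewrite ltxx.
case: (pselect (exists A B, [/\ A \subset X, B \subset Y, #|A| = (n %/ m)%N,
   #|B| = (n %/ m)%N & (1 + kappa) * p * (n %/ m)%:R ^+ 2 < (npairs r A B)%:R])).
  move=> [A [B [AX BY Am Bm hAB]]].
  have nm : ((2 * m) ^ K.+1 <= n %/ m)%N.
    rewrite leq_divRL; last by lia.
    apply: leq_trans nK; rewrite [in leqRHS]expnS; nia.
  have n2m : (n <= 2 * m * (n %/ m))%N.
    apply: leq_double_divn; first exact: ltnW.
    apply: leq_trans nK; rewrite expnS -mulnA mulnCA leq_pmulr //.
    by rewrite muln_gt0 expn_gt0 muln_gt0 (ltnW m2).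
  have pp : p <= (1 + kappa) * p by rewrite mulrDl mul1r lerDl mulr_ge0 // ltW.
  have pK' : 1 < (1 + kappa) ^+ K * ((1 + kappa) * p) by rewrite mulrA -exprSr.
  have [X' [Y' [n' [p' [sX sY cXY [pp' nn'] hc]]]]] :=
    IHK _ _ A B (lt_le_trans p0 pp) Am Bm (ltW hAB) pK' nm.
  exists X', Y', n', p'; split => //.
  - exact: subset_trans AX.
  - exact: subset_trans BY.
  - split; first exact: le_trans pp'.
    apply: leq_trans n2m _; rewrite expnS.
    by rewrite mulnCA leq_mul2l nn' orbT.
move=> hno; exists X, Y, n, p; split => //.
- by split=> //; rewrite leq_pmulr // expn_gt0; lia.
- split=> // A B sA sB cA cB; rewrite leNgt; apply/negP => hlt; apply: hno.
  by exists A, B.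
Qed.

(* If no [b]-by-[b] subpair is much denser than the pair, then none is much
   sparser either, as the density of the pair is an average. *)
Lemma quasirandom_good_pair r (m L n : nat) (p0 p : R) X Y :
  symmetric r -> (2 <= m)%N -> (2 * m <= n)%N -> 0 < p0 -> p0 <= p ->
  2 * L.+1%:R <= m%:R * p0 ->
  let b := (n %/ m)%N in
  [disjoint X & Y] -> #|X| = n -> #|Y| = n ->
  p * n%:R ^+ 2 <= (npairs r X Y)%:R ->
  (forall A B, A \subset X -> B \subset Y -> #|A| = b -> #|B| = b ->
    (npairs r A B)%:R <= (1 + (8 * m%:R ^+ 2)^-1) * p * b%:R ^+ 2) ->
  exists X' Y', [/\ X' \subset X, Y' \subset Y
    & good_pair r X' Y' L b (p0 * b%:R ^+ 2 / 2)].
Proof.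
set kappa := _^-1 => rs m2 mn p00 p0p Lm b dXY Xn Yn pn hb.
have b2 : (2 <= b)%N by rewrite leq_divRL //; lia.
have bn : (b * m <= n)%N by exact: leq_trunc_div.
have nb : (n <= 2 * m * b)%N.
  apply: leq_double_divn; first exact: ltnW.
  by rewrite (leq_trans _ mn) // leq_pmull.
have bbn : (2 * b <= n)%N by apply: leq_trans bn; rewrite mulnC leq_mul2l m2 orbT.
have bb : (b <= n - b)%N.
  by rewrite leq_subRL ?addnn -?mul2n // (leq_trans _ bbn) // leq_pmull.
have bn' : (b <= n)%N := leq_trans bb (leq_subr b n).
clearbody b.
have b0 : 0 < b%:R :> R by rewrite ltr0n ltnW.
have m0 : 0 < m%:R :> R by rewrite ltr0n ltnW.
have k0 : 0 < kappa by rewrite invr_gt0 mulr_gt0 ?exprn_gt0.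
have pp : 0 < p by exact: lt_le_trans p0p.
have nbR : n%:R <= 2 * m%:R * b%:R :> R by rewrite -!natrM ler_nat.
have n0 : 0 < n%:R :> R by rewrite ltr0n (leq_trans _ mn) // muln_gt0 (ltnW m2).
have bbnR : 2 * b%:R <= n%:R :> R by rewrite -natrM ler_nat.
(* Origin of the 8 in [kappa]: a relative excess of [kappa] over the whole pair amounts to at most
   half of what a [b]-by-[b] subpair of density [p] holds. *)
have kn : kappa * n%:R ^+ 2 <= b%:R ^+ 2 / 2.
  rewrite mulrC ler_pdivrMr ?mulr_gt0 ?exprn_gt0 //.
  apply: le_trans (_ : (2 * m%:R * b%:R) ^+ 2 <= _); last by rewrite !exprMn; lra.
  by rewrite lerXn2r // nnegrE ltW // !mulr_gt0.
have big_cnt A B : A \subset X -> B \subset Y -> (b <= #|A|)%N -> (b <= #|B|)%N ->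
    (npairs r A B)%:R <= (1 + kappa) * p * #|A|%:R * #|B|%:R.
  move=> sA sB bA bB.
  have [A' [B' [sA' sB' cA' cB' h]]] := averaging_cnt rs bA bB.
  have := hb A' B' (subset_trans sA' sA) (subset_trans sB' sB) cA' cB'.
  move: h; rewrite -(ler_nat R) !natrM => h1 h2.
  have b20 : 0 < b%:R * b%:R :> R by rewrite mulr_gt0.
  rewrite -(ler_pM2l b20); apply: le_trans h1 _.
  rewrite (_ : b%:R * b%:R * _ =
    #|A|%:R * #|B|%:R * ((1 + kappa) * p * b%:R ^+ 2)); last by ring.
  by rewrite ler_wpM2l // mulr_ge0.
have npairsXD S B : S \subset X -> (npairs r X B = npairs r S B + npairs r (X :\: S) B)%N.
  by move=> sS; rewrite (npairsID r S X) (setIidPr sS).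
have npairsYD A S : S \subset Y -> (npairs r A Y = npairs r A S + npairs r A (Y :\: S))%N.
  move=> sS; rewrite !(npairs_sym A) // (npairsID r S Y) (setIidPr sS).
  by rewrite !(npairs_sym _ A).
have cardXD S Z : S \subset Z -> #|Z| = n -> #|S| = b -> #|Z :\: S| = (n - b)%N.
  by move=> sS cZ cS; rewrite cardsD (setIidPr sS) cS cZ.
have nsubb : (n - b)%:R = n%:R - b%:R :> R by rewrite natrB.
(* Subtract from the whole pair the most that [X :\: A] with [Y], and [A] with [Y :\: B], can hold.
   The main terms leave [p * b ^ 2], and by [kn] the excess eats at most half of it. *)
have dense A B : A \subset X -> B \subset Y -> #|A| = b -> #|B| = b ->
    p * b%:R ^+ 2 / 2 <= (npairs r A B)%:R.
  move=> sA sB cA cB.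
  have h1 := big_cnt _ _ (subsetDl X A) (subxx Y).
  have h2 := big_cnt _ _ sA (subsetDl Y B).
  move: pn h1 h2; rewrite (npairsXD A) // (npairsYD A B) // !natrD.
  rewrite (cardXD A X) // (cardXD B Y) // cA Yn nsubb => pn h1 h2.
  have {}h1 := h1 bb bn'.
  have {}h2 := h2 (leqnn b) bb.
  move: h1 h2.
  move: pn; move: (npairs _ _ _)%:R (npairs _ _ _)%:R (npairs _ _ _)%:R => u v w.
  have : p * (kappa * n%:R ^+ 2) <= p * (b%:R ^+ 2 / 2) by rewrite ler_pM2l.
  have : 0 <= p * kappa * b%:R ^+ 2 by rewrite !mulr_ge0 ?exprn_ge0 // ltW.
  by lra.
have knb : kappa * n%:R <= b%:R / 2.
  rewrite -(ler_pM2r n0) -mulrA -expr2; apply: le_trans kn _.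
  by rewrite expr2; nra.
have lowX S : S \subset X -> #|S| = b -> p * n%:R * b%:R / 2 <= (npairs r S Y)%:R.
  move=> sS cS; have h1 := big_cnt _ _ (subsetDl X S) (subxx Y).
  move: pn h1; rewrite (npairsXD S) // natrD (cardXD S X) // Yn nsubb => pn h1.
  have {h1} := h1 bb bn'.
  move: pn; move: (npairs _ _ _)%:R (npairs _ _ _)%:R => u v.
  have : p * n%:R * (kappa * n%:R) <= p * n%:R * (b%:R / 2).
    by rewrite ler_pM2l // mulr_gt0.
  have : 0 <= p * n%:R * kappa * b%:R by rewrite !mulr_ge0 ?exprn_ge0 // ltW.
  by lra.
have lowY S : S \subset Y -> #|S| = b -> p * n%:R * b%:R / 2 <= (npairs r X S)%:R.
  move=> sS cS; have h1 := big_cnt _ _ (subxx X) (subsetDl Y S).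
  move: pn h1; rewrite (npairsYD X S) // natrD (cardXD S Y) // Xn nsubb => pn h1.
  have {h1} := h1 bn' bb.
  move: pn; move: (npairs _ _ _)%:R (npairs _ _ _)%:R => u v.
  have : p * n%:R * (kappa * n%:R) <= p * n%:R * (b%:R / 2).
    by rewrite ler_pM2l // mulr_gt0.
  have : 0 <= p * n%:R * kappa * b%:R by rewrite !mulr_ge0 ?exprn_ge0 // ltW.
  by lra.
have Lb : L.+1%:R * b%:R <= p * n%:R / 2.
  have h1 : b%:R * m%:R <= n%:R :> R by rewrite -natrM ler_nat.
  have h2 : p0 * (b%:R * m%:R) <= p * n%:R.
    by rewrite ler_pM // ?mulr_ge0 // ltW.
  have : 2 * L.+1%:R * b%:R <= m%:R * p0 * b%:R by rewrite ler_pM2r.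
  by lra.
(* By [low], fewer than [b] vertices have degree below [L.+1 * b]. Exactly [b] vertices are dropped
   on each side, which keeps the sides equal and costs every vertex at most [b] neighbours. *)
have clean Z Z' : #|Z| = n -> #|Z'| = n ->
    (forall S, S \subset Z -> #|S| = b -> p * n%:R * b%:R / 2 <= (npairs r S Z')%:R) ->
    exists Z1 : {set T}, [/\ Z1 \subset Z, #|Z1| = (n - b)%N
      & forall x, x \in Z1 -> (L.+1 * b <= degree r x Z')%N].
  move=> cZ cZ' low; pose W := [set x in Z | (L.+1 * b <= degree r x Z')%N].
  have WZ : W \subset Z by apply/subsetP => x; rewrite inE => /andP[].
  have [bad|good] := leqP b #|Z :\: W|.
    have [S sS cS] := exists_subset_card bad.
    have := low S (subset_trans sS (subsetDl _ _)) cS.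
    have : (npairs r S Z' < b * (L.+1 * b))%N.
      rewrite -{1}cS npairs_lt ?cS ?(ltnW b2) // => s /(subsetP sS).
      by rewrite !inE => /andP[h sZ]; move: h; rewrite sZ /= -ltnNge.
    rewrite -(ltr_nat R) !natrM; move: (npairs _ _ _)%:R => u h1 h2; exfalso.
    have : L.+1%:R * b%:R * b%:R <= p * n%:R / 2 * b%:R by rewrite ler_pM2r.
    by lra.
  have cW : (n - b <= #|W|)%N.
    rewrite leq_subLR addnC -leq_subLR (leq_trans _ (ltnW good)) //.
    by rewrite cardsD (setIidPr WZ) cZ.
  have [Z1 sZ1 cZ1] := exists_subset_card cW.
  exists Z1; split => //; first exact: subset_trans WZ.
  by move=> x /(subsetP sZ1); rewrite inE => /andP[].
have [||X1 [sX1 cX1 dX1]] := clean X Y _ _ lowX => //.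
have [|||Y1 [sY1 cY1 dY1]] := clean Y X => //.
  by move=> S sS cS; rewrite (npairs_sym S) //; exact: lowY.
exists X1, Y1; split => //; split.
- by rewrite (disjointWl sX1) // (disjointWr sY1).
- by rewrite cX1 cY1; split=> //; exact: leq_trans (ltnW b2) bb.
- move=> x xX; rewrite -(leq_add2r b) -mulSnr (leq_trans (dX1 _ xX)) //.
  apply: leq_trans (degreeD r x Y Y1) _.
  by rewrite leq_add2l cardsD (setIidPr sY1) cY1 Yn subKn.
- move=> x xX; rewrite -(leq_add2r b) -mulSnr (leq_trans (dY1 _ xX)) //.
  apply: leq_trans (degreeD r x X X1) _.
  by rewrite leq_add2l cardsD (setIidPr sX1) cX1 Xn subKn.
- move=> A B sA sB bA bB.
  have [A' sA' cA'] := exists_subset_card bA.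
  have [B' sB' cB'] := exists_subset_card bB.
  apply: le_trans (_ : p * b%:R ^+ 2 / 2 <= _).
    by rewrite ler_pM2r ?invr_gt0 // ler_pM2r ?exprn_gt0.
  apply: le_trans (_ : (npairs r A' B')%:R <= _); last by rewrite ler_nat npairsS.
  apply: dense => //; first by rewrite (subset_trans sA') ?(subset_trans sA).
  by rewrite (subset_trans sB') ?(subset_trans sB).
Qed.

End GoodPairs.

(** * Existence of quasirandom pairs on linearly many vertices *)

Lemma bernoulli (R : realType) (x : R) n : 0 <= x -> 1 + n%:R * x <= (1 + x) ^+ n.
Proof.
move=> x0; elim: n => [|n IHn]; first by rewrite mul0r addr0.
rewrite exprSr -natr1.
have : 0 <= n%:R * x * x by rewrite !mulr_ge0.
have := ler_wpM2r (_ : 0 <= 1 + x) IHn; rewrite addr_ge0 // => /(_ isT).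
lra.
Qed.

Lemma dense_good_pair (R : realType) (J delta : R) (L : nat) :
  0 < J -> 0 < delta ->
  exists alpha theta : R, [/\ 0 < alpha, 0 < theta & exists d0 : nat,
  forall d, (d0 <= d)%N -> forall (T : finType) (r : rel T) (S : {set T}),
  symmetric r -> irreflexive r -> #|S|%:R <= J * d%:R ->
  delta * d%:R ^+ 2 <= (npairs r S S)%:R ->
  exists (X Y : {set T}) (b : nat), [/\ X \subset S, Y \subset S, alpha * d%:R <= b%:R
    & good_pair r X Y L b (theta * d%:R ^+ 2)]].
Proof.
move=> J0 delta0.
(* The cut keeps [delta / 4 * d ^ 2] pairs between sides of at most [J * d] vertices. *)
pose p0 := delta / (4 * J ^+ 2).
have p00 : 0 < p0 by rewrite divr_gt0 // mulr_gt0 ?exprn_gt0.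
pose m := (Num.truncn (2 * L.+1%:R / p0)).+2.
have m2 : (2 <= m)%N by [].
have Lm : 2 * L.+1%:R <= m%:R * p0.
  rewrite -ler_pdivrMr //; apply: ltW; apply: lt_trans (truncnS_gt _) _.
  by rewrite ltr_nat.
pose kappa : R := (8 * m%:R ^+ 2)^-1.
have k0 : 0 < kappa by rewrite invr_gt0 mulr_gt0 ?exprn_gt0 ?ltr0n.
pose K := (Num.truncn (p0^-1 / kappa)).+1.
have pK : 1 < (1 + kappa) ^+ K * p0.
  rewrite -ltr_pdivrMr // mul1r; apply: lt_le_trans (bernoulli K (ltW k0)).
  by rewrite ltr_wpDl // -ltr_pdivrMr // truncnS_gt.
(* [K] increments shrink the sides by at most [(2 * m) ^ K]; one more factor leads from a side of
   order [n] to the scale [n %/ m]. *)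
pose N := ((2 * m) ^ K.+1)%N.
have N0 : 0 < N%:R :> R by rewrite ltr0n expn_gt0.
(* If one side had fewer than [c * d] vertices, the cut would hold at most [delta / 8 * d ^ 2]
   pairs, half of what it does hold. *)
pose c := delta / (8 * J).
have c0 : 0 < c by rewrite divr_gt0 // mulr_gt0.
pose alpha := c / 2 / N%:R.
have al0 : 0 < alpha by rewrite divr_gt0 // divr_gt0.
exists alpha, (p0 * alpha ^+ 2 / 2); split=> //.
  by rewrite divr_gt0 // mulr_gt0 ?exprn_gt0.
exists (Num.truncn (N.+1%:R / c)).+1 => d hd T r S rs ri cS eS.
have Ncd : N.+1%:R <= c * d%:R.
  rewrite mulrC -ler_pdivrMr //; apply: ltW; apply: lt_le_trans (truncnS_gt _) _.
  by rewrite ler_nat.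
have d0 : 0 < d%:R :> R by rewrite ltr0n; apply: leq_trans hd.
have cd0 : 0 <= c * d%:R by rewrite mulr_ge0 ?ltW.
pose n0 := Num.truncn (c * d%:R).
have n0le : n0%:R <= c * d%:R by rewrite truncn_le.
have Nn0 : (N <= n0)%N by rewrite truncn_ge_nat // (le_trans _ Ncd) ?ler_nat.
have n0ge : c * d%:R / 2 <= n0%:R.
  have := truncnS_gt (c * d%:R); rewrite -/n0 -natr1.
  have : 1 <= n0%:R :> R.
    by rewrite ler1n; apply: leq_trans Nn0; rewrite expn_gt0.
  lra.
have n00 : 0 < n0%:R :> R.
  by apply: lt_le_trans n0ge; rewrite divr_gt0 // mulr_gt0.
have [A sA cutA] := large_cut S rs ri.
set B := S :\: A in cutA.
have sB : B \subset S := subsetDl S A.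
have cut : delta / 4 * d%:R ^+ 2 <= (npairs r A B)%:R.
  by move: cutA; rewrite -(ler_nat R) natrM => cutA; lra.
have cA : #|A|%:R <= J * d%:R by rewrite (le_trans _ cS) // ler_nat subset_leq_card.
have cB : #|B|%:R <= J * d%:R by rewrite (le_trans _ cS) // ler_nat subset_leq_card.
have cAB : (npairs r A B)%:R <= #|A|%:R * #|B|%:R :> R by rewrite -natrM ler_nat npairs_le.
have cJ : c * d%:R * (J * d%:R) < delta / 4 * d%:R ^+ 2.
  rewrite (_ : c * d%:R * (J * d%:R) = delta / 8 * d%:R ^+ 2).
    by rewrite ltr_pM2r ?exprn_gt0 // ltr_pM2l // ltf_pV2 ?posrE // ltr_nat.
  by rewrite /c; field; rewrite gt_eqF.
have n0A : (n0 <= #|A|)%N.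
  rewrite leqNgt; apply/negP => h.
  have : #|A|%:R * #|B|%:R <= c * d%:R * (J * d%:R).
    by rewrite ler_pM // (le_trans _ n0le) // ler_nat ltnW.
  by lra.
have n0B : (n0 <= #|B|)%N.
  rewrite leqNgt; apply/negP => h.
  have : #|A|%:R * #|B|%:R <= (J * d%:R) * (c * d%:R).
    by rewrite ler_pM // (le_trans _ n0le) // ler_nat ltnW.
  by lra.
have [A' [B' [sA' sB' cA' cB' avg]]] := averaging_cnt rs n0A n0B.
have pAB : p0 * n0%:R ^+ 2 <= (npairs r A' B')%:R.
  have JJ : 0 < (J * d%:R) * (J * d%:R) by rewrite !mulr_gt0.
  rewrite -(ler_pM2l JJ).
  apply: le_trans (_ : #|A|%:R * #|B|%:R * (npairs r A' B')%:R <= _); last first.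
    by rewrite ler_wpM2r // ler_pM.
  move: avg; rewrite -(ler_nat R) !natrM; apply: le_trans.
  rewrite (_ : J * d%:R * (J * d%:R) * (p0 * n0%:R ^+ 2) =
    n0%:R * n0%:R * (delta / 4 * d%:R ^+ 2)).
    by rewrite ler_pM2l // mulr_gt0.
  by rewrite /p0; field; rewrite gt_eqF.
have [X [Y [n [p [sX sY [cX cY] [p0p nn] [pn hb]]]]]] :=
  density_increment m2 p00 cA' cB' pAB pK Nn0.
have mn : (2 * m <= n)%N.
  have : ((2 * m) ^ K * (2 * m) <= (2 * m) ^ K * n)%N.
    by rewrite -expnSr [leqRHS]mulnC; apply: leq_trans nn.
  by rewrite leq_pmul2l // expn_gt0.
have dAB : [disjoint A & B].
  by rewrite disjoints_subset; apply/subsetP => x; rewrite !inE => ->.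
have XA := subset_trans sX sA'; have YB := subset_trans sY sB'.
have dXY : [disjoint X & Y] by rewrite (disjointWl XA) // (disjointWr YB).
have [X' [Y' [sX' sY' [q1 q2 q3 q4 q5]]]] :=
  quasirandom_good_pair rs m2 mn p00 p0p Lm dXY cX cY pn hb.
have bge : alpha * d%:R <= (n %/ m)%:R.
  have h : (n0 <= n %/ m * N)%N.
    apply: leq_trans nn _; rewrite /N expnS mulnA leq_mul2r; apply/orP; right.
    rewrite mulnC leq_double_divn // (leq_trans _ mn) // leq_pmull //.
  rewrite (_ : alpha * d%:R = c * d%:R / 2 / N%:R); last by rewrite /alpha; ring.
  rewrite ler_pdivrMr // -natrM.
  by apply: le_trans n0ge _; rewrite ler_nat.
exists X', Y', (n %/ m)%N; split=> //.
- by rewrite (subset_trans sX') // (subset_trans XA).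
- by rewrite (subset_trans sY') // (subset_trans YB).
split=> // A1 B1 h1 h2 h3 h4; apply: le_trans (q5 A1 B1 h1 h2 h3 h4).
rewrite (_ : p0 * alpha ^+ 2 / 2 * d%:R ^+ 2 = p0 / 2 * (alpha * d%:R) ^+ 2).
  rewrite [leRHS]mulrAC ler_pM2l ?(divr_gt0 p00) // lerXn2r // nnegrE //.
  by rewrite mulr_ge0 // ltW.
by ring.
Qed.

(** * Regular factors *)

Section Factors.
Variable T : finType.
Implicit Types (r m : rel T) (A B S X Y W : {set T}) (E F : {set {set T}}).

Definition image_rel r S Y := [set y in Y | [exists x in S, r x y]].

(** Induction on [#|X|]: a tight proper subset [S] splits the problem into [S] and the rest; without
    one, every proper nonempty subset has a surplus and any edge at [x] may be used. *)
Lemma hall_marriage r X Y :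
  (forall S, S \subset X -> (#|S| <= #|image_rel r S Y|)%N) ->
  exists2 f : T -> T, {in X &, injective f}
    & forall x, x \in X -> (f x \in Y) && r x (f x).
Proof.
move: {2}#|X| (leqnn #|X|) => n; elim: n X Y => [|n IHn] X Y Xn hall.
  move: Xn; rewrite leqn0 cards_eq0 => /eqP->.
  by exists id => x; rewrite inE.
have [X0|[x xX]] := set_0Vmem X.
  by rewrite X0; exists id => x; rewrite inE.
case: (pickP (fun S : {set T} => [&& S \proper X, S != set0
    & (#|image_rel r S Y| <= #|S|)%N])) => [S /and3P[SX S0 tight]|loose].
  have sSX := proper_sub SX.
  have SltX : (#|S| < #|X|)%N by exact: proper_card.
  have [||f finj fY] := IHn S Y; first by rewrite -ltnS (leq_trans SltX).
    by move=> S' sS'; apply: hall; exact: subset_trans sSX.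
  have [||g ginj gY] := IHn (X :\: S) (Y :\: image_rel r S Y).
  - rewrite cardsD (setIidPr sSX) -ltnS (leq_trans _ Xn) //.
    by rewrite ltn_subrL card_gt0 S0 (leq_trans _ SltX).
  - move=> S' sS'; have dSS' : [disjoint S & S'].
      rewrite disjoint_sym (disjointWl sS') // disjoints_subset.
      by apply/subsetP => z; rewrite !inE => /andP[].
    have := hall (S :|: S'); rewrite subUset sSX (subset_trans sS') ?subsetDl //.
    move=> /(_ isT); rewrite cardsU (disjoint_setI0 dSS') cards0 subn0 => h.
    rewrite -(leq_add2l #|S|); apply: leq_trans h _.
    apply: leq_trans (leq_add tight (leqnn _)).
    apply: leq_trans (leq_card_setU _ _).
    apply/subset_leq_card/subsetP => y; rewrite !inE => /andP[yY /existsP[z]].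
    rewrite inE yY /= => /andP[/orP[zS|zS'] rzy].
      by apply/orP; left; apply/existsP; exists z; rewrite zS.
    by case: existsP => //= _; apply/existsP; exists z; rewrite zS'.
  exists (fun z => if z \in S then f z else g z).
    have fg u v : u \in S -> v \in X :\: S -> f u <> g v.
      move=> uS vS fgE; have /andP[] := gY v vS.
      have /andP[fuY rfu] := fY u uS; rewrite inE -fgE => /andP[/negP[]].
      by rewrite inE fuY; apply/existsP; exists u; rewrite uS.
    move=> u v uX vX; case: ifP => uS; case: ifP => vS.
    - exact: finj.
    - by move=> /fg[] //; rewrite inE vS.
    - by move=> /esym/fg[] //; rewrite inE uS.
    - by apply: ginj; rewrite inE ?uS ?vS.
  move=> z zX; case: ifPn => zS; first exact: fY.
  have /andP[] := gY z ltac:(by rewrite inE zS).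
  by rewrite inE => /andP[_ ->] ->.
have [y yY rxy] : exists2 y, y \in Y & r x y.
  have := hall [set x]; rewrite sub1set cards1 => /(_ xX)/card_gt0P[y].
  by rewrite inE => /andP[yY /existsP[z /andP[/set1P->]]]; exists y.
have [||f finj fY] := IHn (X :\ x) (Y :\ y).
- by move: Xn; rewrite (cardsD1 x X) xX.
- move=> S sS; have [->|S0] := eqVneq S set0; first by rewrite cards0.
  have := loose S; rewrite S0 (sub_proper_trans sS) ?properD1 //=.
  move=> /negbT; rewrite -ltnNge => h.
  rewrite -ltnS (leq_trans h) // (cardsD1 y (image_rel r S Y)) -add1n leq_add ?leq_b1 //.
  by apply/subset_leq_card/subsetP => z; rewrite !inE andbA.
exists (fun z => if z == x then y else f z).
  have fy z : z \in X -> z != x -> f z != y.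
    move=> zX zx; have := fY z; rewrite !inE zx zX => /(_ isT).
    by case/andP=> /andP[].
  move=> u v uX vX; case: eqP => [->|/eqP ux]; case: eqP => [->|/eqP vx] // h.
  - by have := fy v vX vx; rewrite h eqxx.
  - by have := fy u uX ux; rewrite h eqxx.
  - by apply: finj; rewrite ?inE ?ux ?vx.
move=> z zX; case: eqP => [->|/eqP zx]; first by rewrite yY.
by have := fY z; rewrite !inE zx zX => /(_ isT)/andP[/andP[_ ->] ->].
Qed.

(* Hall's condition survives the deletion of fewer than [b] perfect matchings:
   small sets expand by the degree condition, large ones by quasirandomness. *)
Lemma good_pair_factor (R : realType) r X Y b (e0 : R) k :
  symmetric r -> good_pair r X Y 3 b e0 -> (0 < b)%N ->
  (k <= b)%N -> k%:R * #|X|%:R < e0 ->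
  exists m, [/\ forall x y, m x y -> [&& x \in X, y \in Y & r x y],
    forall x, x \in X -> degree m x Y = k
  & forall y, y \in Y -> degree (fun y x => m x y) y X = k].
Proof.
move=> rs [dXY [cXY X0] degX degY dense] b0.
elim: k => [|k IHk] kb ke0.
  exists (fun _ _ => false); split=> // x _; apply/eqP; rewrite cards_eq0;
  by apply/eqP/setP => y; rewrite !inE andbF.
have ke0' : k%:R * #|X|%:R < e0.
  by apply: le_lt_trans ke0; rewrite ler_wpM2r // ler_nat.
have [m [mr mX mY]] := IHk (ltnW kb) ke0'.
pose r' x y := r x y && ~~ m x y.
have degX' x : x \in X -> (2 * b <= degree r' x Y)%N.
  move=> xX; rewrite -(leq_add2r b) -mulSnr; apply: leq_trans (degX x xX) _.
  apply: leq_trans (leq_add (leqnn _) (ltnW kb)); rewrite -(mX x xX).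
  apply: leq_trans (leq_card_setU _ _); apply/subset_leq_card/subsetP => y.
  by rewrite !inE /r' => /andP[-> ->]; case: (m x y).
have degY' y : y \in Y -> (2 * b <= degree (fun y x => r' x y) y X)%N.
  move=> yY; rewrite -(leq_add2r b) -mulSnr; apply: leq_trans (degY y yY) _.
  apply: leq_trans (leq_add (leqnn _) (ltnW kb)); rewrite -(mY y yY).
  apply: leq_trans (leq_card_setU _ _); apply/subset_leq_card/subsetP => x.
  by rewrite !inE /r' rs => /andP[-> ->]; case: (m x y).
have hall S : S \subset X -> (#|S| <= #|image_rel r' S Y|)%N.
  move=> sSX; rewrite leqNgt; apply/negP => small.
  have Nsub : image_rel r' S Y \subset Y.
    by apply/subsetP => y; rewrite inE => /andP[].
  pose Q := Y :\: image_rel r' S Y.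
  have cQ : (#|X :\: S| < #|Q|)%N.
    rewrite !cardsD (setIidPr sSX) (setIidPr Nsub) cXY ltn_sub2l //.
    by rewrite -cXY (leq_trans small) // subset_leq_card.
  have noedge x y : x \in S -> y \in Q -> ~~ r' x y.
    move=> xS; rewrite !inE => /andP[h yY]; apply: contra h => rxy.
    by rewrite yY; apply/existsP; exists x; rewrite xS.
  have bS : (b <= #|S|)%N.
    have [x xS] : exists x, x \in S by apply/set0Pn; rewrite -card_gt0 (leq_trans _ small).
    have := degX' x (subsetP sSX x xS) => h; apply: leq_trans (ltnW small).
    apply: leq_trans (leq_trans h _); first by rewrite leq_pmull.
    apply/subset_leq_card/subsetP => y; rewrite !inE => /andP[-> rxy] /=.
    by apply/existsP; exists x; rewrite xS.
  have bQ : (b <= #|Q|)%N.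
    have [y yQ] : exists y, y \in Q by apply/set0Pn; rewrite -card_gt0 (leq_trans _ cQ).
    have yY : y \in Y by move: yQ; rewrite inE => /andP[].
    have := degY' y yY => h; apply: leq_trans (ltnW cQ).
    apply: leq_trans (leq_trans h _); first by rewrite leq_pmull.
    apply/subset_leq_card/subsetP => x; rewrite !inE => /andP[-> rxy] /=.
    by rewrite andbT; apply: contraL rxy => xS; exact: noedge.
  (* Every [r]-pair between [S] and [Q] was deleted with the earlier matchings, hence there are at
     most [k * #|X|] of them, fewer than quasirandomness provides. *)
  have := dense S Q sSX (subsetDl _ _) bS bQ; rewrite leNgt => /negP; apply.
  apply: le_lt_trans ke0'; rewrite -natrM ler_nat mulnC npairsE.
  apply: (@leq_trans (\sum_(x in S) k)); last first.
    by rewrite sum_nat_const leq_mul2r subset_leq_card ?orbT.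
  apply: leq_sum => x xS; rewrite -(mX x (subsetP sSX x xS)).
  apply/subset_leq_card/subsetP => y; rewrite inE => /andP[yQ rxy].
  have := noedge x y xS yQ; rewrite /r' rxy negbK inE => ->.
  by move: yQ; rewrite inE andbT => /andP[].
have [f finj fY] := hall_marriage hall.
have fimg : f @: X = Y.
  apply/eqP; rewrite eqEcard card_in_imset // cXY leqnn andbT.
  by apply/subsetP => _ /imsetP[x xX ->]; have /andP[] := fY x xX.
exists (fun x y => m x y || (x \in X) && (y == f x)); split.
- move=> x y /orP[/mr //|/andP[xX /eqP->]].
  by have /andP[-> /andP[-> _]] := fY x xX; rewrite xX.
- move=> x xX; have /andP[fxY /andP[_ nm]] := fY x xX.
  rewrite /degree (cardsD1 (f x)) inE fxY xX eqxx orbT /= add1n -(mX x xX).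
  congr _.+1; apply: eq_card => y; rewrite !inE; case: eqP => [->|_] /=.
    by rewrite (negPf nm) andbF.
  by rewrite orbF.
- move=> y yY; have /imsetP[x xX yE] : y \in f @: X by rewrite fimg.
  have /andP[fxY /andP[_ nm]] := fY x xX.
  rewrite /degree (cardsD1 x) inE xX yE eqxx orbT /= add1n -(mY y yY).
  congr _.+1; apply: eq_card => z; rewrite !inE yE; case: eqP => [->|zx] /=.
    by rewrite (negPf nm) andbF.
  case zX: (z \in X) => //=; rewrite (_ : _ == _ = false) ?orbF //.
  by apply/eqP => /(finj _ _ xX zX) /esym.
Qed.

(** From here on a graph is a bare set of edges, and the vertex set is supplied where it matters;
    unions and restrictions of graphs are then plain set operations. *)
Definition eadj E : rel T := fun x y => [set x; y] \in E.

Lemma eadj_sym E : symmetric (eadj E).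
Proof. by move=> x y; rewrite /eadj setUC. Qed.

Lemma eadj_irr E : (forall e, e \in E -> #|e| = 2) -> irreflexive (eadj E).
Proof.
by move=> E2 x; apply/negP => /E2; rewrite setUid cards1.
Qed.

Definition regular_on k F W :=
  (forall e, e \in F -> e \subset W) /\
  (forall v, v \in W -> degree (eadj F) v W = k).

Lemma set2_eq (x y u v : T) : ([set x; y] == [set u; v]) =
  ((x == u) && (y == v)) || ((x == v) && (y == u)).
Proof.
apply/eqP/idP => [E|/orP[] /andP[/eqP-> /eqP->] //]; last by rewrite setUC.
have : x \in [set u; v] by rewrite -E set21.
have : y \in [set u; v] by rewrite -E set22.
have : u \in [set x; y] by rewrite E set21.
have : v \in [set x; y] by rewrite E set22.
rewrite !inE (eq_sym u x) (eq_sym u y) (eq_sym v x) (eq_sym v y).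
by do 4!case: (_ == _).
Qed.

Lemma good_pair_regular_on (R : realType) E X Y b (e0 : R) k :
  good_pair (eadj E) X Y 3 b e0 -> (0 < b)%N ->
  (k <= b)%N -> k%:R * #|X|%:R < e0 ->
  exists2 F : {set {set T}}, F \subset E & regular_on k F (X :|: Y).
Proof.
move=> gp b0 kb ke0.
have [m [mE mX mY]] := good_pair_factor (eadj_sym E) gp b0 kb ke0.
have [dXY _ _ _ _] := gp.
pose F := [set e | [exists x, exists y, m x y && (e == [set x; y])]].
have FP x y : eadj F x y = m x y || m y x.
  rewrite /eadj inE; apply/existsP/idP => [[u /existsP[v /andP[muv]]]|].
    by rewrite set2_eq => /orP[] /andP[/eqP-> /eqP->]; rewrite muv ?orbT.
  case/orP => h; first by exists x; apply/existsP; exists y; rewrite h eqxx.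
  by exists y; apply/existsP; exists x; rewrite h setUC eqxx.
have nXY z : z \in X -> z \in Y -> False.
  by move=> zX zY; rewrite (disjointFr dXY zX) in zY.
exists F.
  apply/subsetP => e; rewrite inE => /existsP[x /existsP[y /andP[mxy /eqP->]]].
  by have /and3P[] := mE _ _ mxy.
split=> [e|v].
  rewrite inE => /existsP[x /existsP[y /andP[mxy /eqP->]]].
  have /and3P[xX yY _] := mE _ _ mxy.
  by rewrite subUset !sub1set !inE xX yY orbT.
rewrite inE => /orP[vX|vY].
  rewrite -(mX v vX); apply: eq_card => y; rewrite !inE FP.
  apply/andP/andP => [[yXY /orP[] h]|[yY h]].
  - by have /and3P[] := mE _ _ h.
  - by have /and3P[_ vY] := mE _ _ h; case: (nXY v).
  - by rewrite yY h orbT.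
rewrite -(mY v vY); apply: eq_card => y; rewrite !inE FP.
apply/andP/andP => [[yXY /orP[] h]|[yX h]].
- by have /and3P[vX] := mE _ _ h; case: (nXY v).
- by have /and3P[] := mE _ _ h.
- by rewrite yX h orbT.
Qed.

End Factors.

(** * Cut-density *)

Section CutDensity.
Variables (R : realType) (T : finType).
Implicit Types (r : rel T) (A B S X Y Z U : {set T}) (E F : {set {set T}}).

(** Edges of [E] may leave [Z], which makes the property monotone in [E]. *)
Definition cut_dense_on (rho : R) E Z : Prop :=
  forall A B, A :|: B = Z -> [disjoint A & B] ->
    rho * #|A|%:R * #|B|%:R <= (npairs (eadj E) A B)%:R.

Lemma eadjS E F : E \subset F -> subrel (eadj E) (eadj F).
Proof. by move=> /subsetP sEF x y /sEF. Qed.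

Lemma sub_degree r r' x A : subrel r r' -> (degree r x A <= degree r' x A)%N.
Proof.
move=> sr; apply/subset_leq_card/subsetP => y; rewrite !inE.
by case/andP=> -> /sr.
Qed.

Lemma sub_cnt r r' A B : subrel r r' -> (npairs r A B <= npairs r' A B)%N.
Proof. by move=> sr; rewrite !npairsE leq_sum // => x _; exact: sub_degree. Qed.

Lemma npairs_eadjC E A B : npairs (eadj E) A B = npairs (eadj E) B A.
Proof. exact/npairs_sym/eadj_sym. Qed.

Lemma npairs_ge_real r A B (c : R) :
  (forall x, x \in A -> c <= (degree r x B)%:R) -> #|A|%:R * c <= (npairs r A B)%:R.
Proof.
move=> h; rewrite npairsE natr_sum -sumr_const mulr_suml.
by apply: ler_sum => x xA; rewrite mul1r h.
Qed.

Lemma card_setIU Z Z' A B : A :|: B = Z :|: Z' ->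
  (#|B| <= #|B :&: Z| + #|B :&: Z'|)%N.
Proof.
move=> AB; apply: leq_trans (leq_card_setU _ _).
by rewrite -setIUr -AB subset_leq_card // subsetI subxx subsetUr.
Qed.

Lemma cut_dense_onW (rho rho' : R) E E' Z :
  rho' <= rho -> E \subset E' -> cut_dense_on rho E Z -> cut_dense_on rho' E' Z.
Proof.
move=> le_rho sE cZ A B AB dAB; apply: le_trans (_ : (npairs (eadj E) A B)%:R <= _).
  by apply: le_trans (cZ A B AB dAB); rewrite !ler_wpM2r.
by rewrite ler_nat sub_cnt //; exact: eadjS.
Qed.

Lemma disjointIl A B Z : [disjoint A & B] -> [disjoint A :&: Z & B :&: Z].
Proof. by move=> dAB; rewrite (disjointWl (subsetIl _ _)) // (disjointWr (subsetIl _ _)). Qed.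

(** One side of the cut, say [A], contains half of [Z :&: Z']. Cut-density of [Z] and of [Z'] then
    bounds the crossing edges below by [beta * (eta * D / 2)] times [#|B :&: Z|], respectively
    [#|B :&: Z'|]. The same edges may be counted in both bounds, so their average is taken: the 4 is
    this 2 times the half of the overlap. *)
Lemma cut_dense_on_union (beta eta M D : R) E Z Z' :
  0 <= beta -> 0 <= eta -> 0 < M -> 0 < D ->
  cut_dense_on beta E Z -> cut_dense_on beta E Z' ->
  eta * D <= #|Z :&: Z'|%:R -> #|Z :|: Z'|%:R <= M * D ->
  cut_dense_on (beta * (eta / (4 * M))) E (Z :|: Z').
Proof.
move=> beta0 eta0 M0 D0 cZ cZ' hI hM.
have main A B : A :|: B = Z :|: Z' -> [disjoint A & B] ->
    eta * D / 2 <= #|A :&: (Z :&: Z')|%:R ->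
    beta * (eta / (4 * M)) * #|A|%:R * #|B|%:R <= (npairs (eadj E) A B)%:R.
  move=> AB dAB hA.
  have part V : cut_dense_on beta E V -> V \subset Z :|: Z' ->
      eta * D / 2 <= #|A :&: V|%:R ->
      beta * (eta * D / 2) * #|B :&: V|%:R <= (npairs (eadj E) A B)%:R.
    move=> cV sV hV; apply: le_trans (_ : (npairs (eadj E) (A :&: V) (B :&: V))%:R <= _).
      apply: le_trans (cV _ _ _ (disjointIl V dAB)).
        by rewrite ler_wpM2r // ler_wpM2l.
      by rewrite -setIUl AB; apply/setIidPr.
    by rewrite ler_nat npairsS // subsetIl.
  have hAV (V : {set T}) : Z :&: Z' \subset V -> eta * D / 2 <= #|A :&: V|%:R.
    by move=> sV; apply: le_trans hA _; rewrite ler_nat subset_leq_card // setIS.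
  have h1 := part Z cZ (subsetUl _ _) (hAV Z (subsetIl _ _)).
  have h2 := part Z' cZ' (subsetUr _ _) (hAV Z' (subsetIr _ _)).
  have hB : #|B|%:R <= #|B :&: Z|%:R + #|B :&: Z'|%:R :> R.
    by rewrite -natrD ler_nat; exact: card_setIU AB.
  have hA' : #|A|%:R <= M * D.
    by apply: le_trans hM; rewrite ler_nat subset_leq_card // -AB subsetUl.
  have c0 : 0 <= beta * (eta / (4 * M)) by rewrite mulr_ge0 // divr_ge0 // mulr_ge0 // ltW.
  apply: le_trans (_ : beta * (eta / (4 * M)) * (M * D) * #|B|%:R <= _).
    by rewrite ler_wpM2r // ler_wpM2l.
  rewrite (_ : _ * (M * D) = beta * (eta * D / 2) / 2); last first.
    by field; rewrite gt_eqF.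
  have := ler_wpM2l (_ : 0 <= beta * (eta * D / 2)) hB.
  rewrite mulr_ge0 ?divr_ge0 ?mulr_ge0 ?(ltW D0) // => /(_ isT).
  by lra.
move=> A B AB dAB.
have [hA|hA] := lerP (eta * D / 2) #|A :&: (Z :&: Z')|%:R; first exact: main.
rewrite npairs_eadjC.
rewrite mulrAC; apply: main; rewrite 1?setUC // 1?disjoint_sym //.
have : #|Z :&: Z'|%:R <= #|A :&: (Z :&: Z')|%:R + #|B :&: (Z :&: Z')|%:R :> R.
  rewrite -natrD ler_nat; apply: leq_trans (leq_card_setU _ _).
  rewrite -setIUl AB subset_leq_card // subsetI subxx andbT.
  by rewrite (subset_trans (subsetIl _ _)) // subsetUl.
by lra.
Qed.

(** If both sides contain [alpha * D / 2] vertices of [Z], cut-density of [Z] suffices. Otherwise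
    one side [B] contains fewer; then each vertex of [B] outside [Z] keeps [alpha * D / 2]
    neighbours in [A :&: Z], and those of [B] in [Z] are served by cut-density of [Z]. *)
Lemma cut_dense_on_attach (beta alpha M D : R) E Z U :
  0 <= beta -> beta <= 1 -> 0 < alpha -> 0 < D ->
  cut_dense_on beta E Z -> alpha * D <= #|Z|%:R ->
  (forall u, u \in U -> u \notin Z -> alpha * D <= (degree (eadj E) u Z)%:R) ->
  #|Z :|: U|%:R <= M * D ->
  cut_dense_on (beta * (alpha ^+ 2 / (4 * M ^+ 2))) E (Z :|: U).
Proof.
move=> beta0 beta1 alpha0 D0 cZ hZ hU hM.
have aM : alpha <= M.
  rewrite -(ler_pM2r D0); apply: le_trans hZ (le_trans _ hM).
  by rewrite ler_nat subset_leq_card // subsetUl.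
have M0 : 0 < M by exact: lt_le_trans aM.
have aD0 : 0 < alpha * D by rewrite mulr_gt0.
have c0 : 0 <= beta * (alpha ^+ 2 / (4 * M ^+ 2)).
  by rewrite mulr_ge0 // divr_ge0 ?exprn_ge0 ?mulr_ge0 ?exprn_ge0 // ltW.
have sizeM A B : A :|: B = Z :|: U -> #|A|%:R <= M * D.
  by move=> AB; apply: le_trans hM; rewrite ler_nat subset_leq_card // -AB subsetUl.
have base A B : A :|: B = Z :|: U -> [disjoint A & B] ->
    beta * #|A :&: Z|%:R * #|B :&: Z|%:R <= (npairs (eadj E) A B)%:R.
  move=> AB dAB; apply: le_trans (cZ _ _ _ (disjointIl Z dAB)) _.
    by rewrite -setIUl AB; apply/setIidPr; exact: subsetUl.
  by rewrite ler_nat npairsS // subsetIl.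
have splitZ A B : A :|: B = Z :|: U -> [disjoint A & B] ->
    Z :\: (A :&: Z) = B :&: Z.
  move=> AB dAB; apply/setP => z; rewrite !inE.
  have := congr1 (fun S : {set T} => z \in S) AB; rewrite !inE.
  case zZ: (z \in Z) => /=; rewrite ?andbF // !andbT => /orP[zA|zB].
    by rewrite zA (disjointFr dAB zA).
  by rewrite zB (disjointFl dAB zB).
have main A B : A :|: B = Z :|: U -> [disjoint A & B] ->
    #|B :&: Z|%:R < alpha * D / 2 -> 
    beta * (alpha ^+ 2 / (4 * M ^+ 2)) * #|A|%:R * #|B|%:R <= (npairs (eadj E) A B)%:R.
  move=> AB dAB hB; have h0 := base A B AB dAB.
  have ZAB := splitZ A B AB dAB.
  have cardZ : #|Z|%:R = #|A :&: Z|%:R + #|B :&: Z|%:R :> R.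
    by rewrite -ZAB -natrD -(cardsID A Z) [Z :&: A]setIC setDIr setDv setU0.
  have hA : alpha * D / 2 <= #|A :&: Z|%:R by lra.
  have h1 : #|B :\: Z|%:R * (alpha * D / 2) <= (npairs (eadj E) A B)%:R.
    rewrite (npairs_eadjC _ A).
    apply: le_trans (_ : (npairs (eadj E) (B :\: Z) (A :&: Z))%:R <= _); last first.
      by rewrite ler_nat npairsS ?subsetDl ?subsetIl.
    apply: npairs_ge_real => u; rewrite inE => /andP[uZ uB].
    have uU : u \in U.
      have : u \in Z :|: U by rewrite -AB inE uB orbT.
      by rewrite inE (negPf uZ).
    have := hU u uU uZ; have := degreeD (eadj E) u Z (A :&: Z).
    rewrite ZAB -(ler_nat R) natrD; lra.
  have h2 : beta * (alpha * D / 2) * #|B :&: Z|%:R <= (npairs (eadj E) A B)%:R.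
    by apply: le_trans h0; rewrite ler_wpM2r // ler_wpM2l.
  have h3 : beta * (alpha * D / 2) * #|B :\: Z|%:R <= (npairs (eadj E) A B)%:R.
    apply: le_trans h1; rewrite mulrC; rewrite ler_wpM2l //.
    by rewrite ler_piMl // divr_ge0 // ltW.
  have hB2 : #|B|%:R = #|B :&: Z|%:R + #|B :\: Z|%:R :> R.
    by rewrite -natrD cardsID.
  apply: le_trans (_ : beta * (alpha ^+ 2 / (4 * M ^+ 2)) * (M * D) * #|B|%:R <= _).
    by rewrite ler_wpM2r // ler_wpM2l // (sizeM A B).
  apply: le_trans (_ : beta * (alpha * D / 2) / 2 * #|B|%:R <= _); last first.
    by rewrite hB2; lra.
  rewrite ler_wpM2r //.
  rewrite [leLHS](_ : _ = beta * (alpha * D / 4 * (alpha / M))); last first.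
    by field; rewrite gt_eqF.
  rewrite [leRHS](_ : _ = beta * (alpha * D / 4)); last by field.
  rewrite ler_wpM2l // ler_piMr ?ler_pdivrMr ?mul1r //.
  by rewrite divr_ge0 // ltW.
move=> A B AB dAB.
have BA : B :|: A = Z :|: U by rewrite setUC.
have dBA : [disjoint B & A] by rewrite disjoint_sym.
have [hB|hB] := ltrP #|B :&: Z|%:R (alpha * D / 2); first exact: main.
have [hA|hA] := ltrP #|A :&: Z|%:R (alpha * D / 2).
  by rewrite npairs_eadjC mulrAC; exact: main.
apply: le_trans (base A B AB dAB).
apply: le_trans (_ : beta * (alpha * D / 2) * (alpha * D / 2) <= _); last first.
  by rewrite ler_pM // ?mulr_ge0 ?invr_ge0 ?ler_wpM2l // ltW.
apply: le_trans (_ : beta * (alpha ^+ 2 / (4 * M ^+ 2)) * (M * D) * (M * D) <= _).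
  apply: ler_pM => //; first exact: mulr_ge0.
    by rewrite ler_wpM2l // (sizeM A B).
  exact: sizeM BA.
by rewrite le_eqVlt; apply/orP; left; apply/eqP; field; rewrite gt_eqF.
Qed.

Lemma good_pair_width X Y r L b (e0 : R) : good_pair r X Y L b e0 -> (L * b <= #|X|)%N.
Proof.
case=> _ [cXY /card_gt0P[x xX]] /(_ x xX) h _ _; rewrite cXY.
exact: leq_trans h (degree_le _ _ _).
Qed.

(** Either opposite parts of the cut have [b] vertices in [X] and in [Y], and quasirandomness
    applies, or one part has fewer than [b] vertices in both, and each of its vertices, having
    degree at least [3 * b], sends [b] edges across. *)
Lemma good_pair_cutd (alpha theta M D c : R) E X Y L b :
  (3 <= L)%N -> 0 < M -> 0 < D -> 0 <= c ->
  good_pair (eadj E) X Y L b (theta * D ^+ 2) -> alpha * D <= b%:R ->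
  #|X :|: Y|%:R <= M * D -> c <= theta / M ^+ 2 -> c <= alpha / M ->
  cut_dense_on c E (X :|: Y).
Proof.
move=> L3 M0 D0 c0 gp hb hM hc1 hc2.
have h3b := good_pair_width gp.
have [dXY [cXY X0] degX degY dense] := gp.
have {}h3b : (3 * b <= #|X|)%N by rewrite (leq_trans _ h3b) // leq_mul2r L3 orbT.
have sizeM A B : A :|: B = X :|: Y -> #|A|%:R <= M * D.
  by move=> AB; apply: le_trans hM; rewrite ler_nat subset_leq_card // -AB subsetUl.
have big A B : A :|: B = X :|: Y -> (b <= #|A :&: X|)%N -> (b <= #|B :&: Y|)%N ->
    c * #|A|%:R * #|B|%:R <= (npairs (eadj E) A B)%:R.
  move=> AB hA hB; apply: le_trans (_ : (npairs (eadj E) (A :&: X) (B :&: Y))%:R <= _).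
    apply: le_trans (dense _ _ (subsetIr _ _) (subsetIr _ _) hA hB).
    apply: le_trans (_ : c * (M * D) * (M * D) <= _).
      apply: ler_pM => //; first exact: mulr_ge0.
        by rewrite ler_wpM2l // (sizeM A B).
      by rewrite (sizeM B A) // setUC.
    rewrite -mulrA -expr2 exprMn mulrA ler_wpM2r ?exprn_ge0 ?(ltW D0) //.
    by rewrite -ler_pdivlMr ?exprn_gt0.
  by rewrite ler_nat npairsS // subsetIl.
have small A B : A :|: B = X :|: Y -> (#|A :&: X| < b)%N -> (#|A :&: Y| < b)%N ->
    c * #|A|%:R * #|B|%:R <= (npairs (eadj E) A B)%:R.
  move=> AB hX hY.
  apply: le_trans (_ : c * #|A|%:R * (M * D) <= _).
    by rewrite ler_wpM2l ?mulr_ge0 // (sizeM B A) // setUC.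
  apply: le_trans (_ : #|A|%:R * b%:R <= _).
    rewrite mulrAC mulrC ler_wpM2l // (le_trans _ hb) //.
    by rewrite mulrA ler_wpM2r ?(ltW D0) // -ler_pdivlMr.
  rewrite -natrM ler_nat; apply: npairs_ge => x xA.
  have go (W : {set T}) : W \subset X :|: Y ->
      (L * b <= degree (eadj E) x W)%N -> (#|A :&: W| < b)%N -> (b <= degree (eadj E) x B)%N.
    move=> sW hL hW.
    have h1 := degreeD (eadj E) x W B.
    have h2 : (#|W :\: B| <= #|A :&: W|)%N.
      apply/subset_leq_card/subsetP => z; rewrite !inE => /andP[zB zW].
      rewrite zW andbT; have := subsetP sW z zW; rewrite -AB inE (negPf zB) orbF //.
    have h4 : (3 * b <= L * b)%N by rewrite leq_mul2r L3 orbT.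
    rewrite -(leq_add2r b); apply: leq_trans (leq_trans _ (leq_trans hL h1)) _.
      by apply: leq_trans h4; rewrite addnn -mul2n leq_mul2r orbT.
    by rewrite leq_add2l ltnW // (leq_ltn_trans h2).
  have : x \in X :|: Y by rewrite -AB inE xA.
  rewrite inE => /orP[/degX|/degY] h; first exact: go (subsetUr _ _) h hY.
  exact: go (subsetUl _ _) h hX.
have swap A B (V : {set T}) : A :|: B = X :|: Y -> [disjoint A & B] -> V \subset X :|: Y ->
    #|V| = #|X| -> (#|A :&: V| < b)%N -> (b <= #|B :&: V|)%N.
  move=> AB dAB sV cV hA; have : (#|V| <= #|A :&: V| + #|B :&: V|)%N.
    apply: leq_trans (leq_card_setU _ _); rewrite -setIUl AB.
    by rewrite subset_leq_card // subsetI sV subxx.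
  rewrite cV => h; rewrite leqNgt; apply/negP => hB.
  have := leq_trans h3b h; rewrite leqNgt => /negP; apply.
  apply: leq_trans (leq_add hA (ltnW hB)) _.
  by rewrite addnn -mul2n leq_mul2r orbT.
move=> A B AB dAB.
have BA : B :|: A = X :|: Y by rewrite setUC.
have dBA : [disjoint B & A] by rewrite disjoint_sym.
have [hAX|hAX] := leqP b #|A :&: X|.
  have [hBY|hBY] := leqP b #|B :&: Y|; first exact: big.
  have hAY := swap B A Y BA dBA (subsetUr _ _) (esym cXY) hBY.
  rewrite npairs_eadjC mulrAC.
  have [hBX|hBX] := leqP b #|B :&: X|; first exact: big.
  exact: small.
have hBX := swap A B X AB dAB (subsetUl _ _) erefl hAX.
have [hAY|hAY] := leqP b #|A :&: Y|; last exact: small.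
by rewrite npairs_eadjC mulrAC; exact: big.
Qed.

End CutDensity.

(** * Atoms *)

Definition bip_edges (T : finType) (X Y : {set T}) : {set {set T}} :=
  [set [set x; y] | x in X, y in Y].

Lemma good_pair_transfer (R : realType) (T : finType) (r r' : rel T)
    (X Y : {set T}) L b (e0 : R) :
  symmetric r -> symmetric r' ->
  (forall x y, x \in X -> y \in Y -> r x y = r' x y) ->
  good_pair r X Y L b e0 -> good_pair r' X Y L b e0.
Proof.
move=> rs rs' rr' [dXY cXY degX degY dense].
have degE x (Z : {set T}) : x \in X -> Z \subset Y -> degree r x Z = degree r' x Z.
  move=> xX /subsetP sZ; apply: eq_card => y; rewrite !inE.
  by case yZ: (y \in Z) => //=; rewrite rr' // sZ.
split=> // [x xX|y yY|A B sA sB bA bB].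
- by rewrite -degE // degX.
- rewrite (leq_trans (degY y yY)) //; apply/eq_leq/eq_card => x; rewrite !inE.
  by case xX: (x \in X) => //=; rewrite rs rs' rr'.
- apply: le_trans (dense A B sA sB bA bB) _; rewrite ler_nat !npairsE.
  by rewrite leq_sum // => x xA; rewrite degE // (subsetP sA).
Qed.

(* The two sides of a good pair, its edges, and its scale [b]. *)
Definition atom (T : finType) : finType :=
  ({set T} * {set T} * {set {set T}} * 'I_#|T|.+1)%type.

Section Atoms.
Variables (R : realType) (T : finType).
Implicit Types (P : atom T) (E : {set {set T}}) (W Z : {set T}).

Definition lside P : {set T} := P.1.1.1.
Definition rside P : {set T} := P.1.1.2.
Definition aedges P : {set {set T}} := P.1.2.
Definition width P : nat := P.2.
Definition averts P : {set T} := lside P :|: rside P.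

Variables (J alpha theta : R) (L d : nat).

Definition is_atom P : Prop :=
  [/\ good_pair (eadj (aedges P)) (lside P) (rside P) L (width P) (theta * d%:R ^+ 2),
      alpha * d%:R <= (width P)%:R, #|averts P|%:R <= J * d%:R
    & aedges P \subset bip_edges (lside P) (rside P)].

Definition nearly_inside P W : bool :=
  (#|lside P :\: W| < width P)%N || (#|rside P :\: W| < width P)%N.

Lemma nearly_insideS P W Z : W \subset Z -> nearly_inside P W -> nearly_inside P Z.
Proof.
move=> sWZ /orP[h|h]; apply/orP; [left|right]; apply: leq_ltn_trans h;
by rewrite subset_leq_card // setDS.
Qed.

Lemma aedge_sub P e : is_atom P -> e \in aedges P -> e \subset averts P.
Proof.
case=> _ _ _ /subsetP h /h/imset2P[x y xX yY ->].
by rewrite subUset !sub1set !inE xX yY orbT.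
Qed.

Lemma aedge_card P e : is_atom P -> e \in aedges P -> #|e| = 2.
Proof.
case=> [[dXY _ _ _ _]] _ _ /subsetP h /h/imset2P[x y xX yY ->].
by rewrite cards2; case: eqP => // xy; rewrite -xy (disjointFr dXY xX) in yY.
Qed.

Lemma aedges_size P : is_atom P -> (#|lside P| * (L * width P) <= #|aedges P|)%N.
Proof.
case=> [[dXY _ degX _ _]] _ _ _; apply: leq_trans (npairs_ge degX) _.
rewrite /npairs; set V := (X in (#|pred_of_set X| <= _)%N).
rewrite -(@card_in_imset _ _ (fun p : T * T => [set p.1; p.2]) V).
  by apply/subset_leq_card/subsetP => _ /imsetP[p + ->]; rewrite inE => /andP[].
move=> [x y] [u v]; rewrite !inE /= => /andP[/andP[xX yY] _] /andP[/andP[uX vY] _].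
move=> /eqP; rewrite set2_eq => /orP[/andP[/eqP-> /eqP->] //|/andP[/eqP xv _]].
by rewrite xv (disjointFl dXY vY) in xX.
Qed.

(** Compared with [aedges_size]: [2 * width P] vertices meet at most a fraction [4 / L] of the edges
    of the atom. This is why [L] is taken of order [4 / epsilon]. *)
Lemma aedges_touch P W : is_atom P ->
  (#|[set e in aedges P | ~~ [disjoint e & W]]| <= 2 * #|lside P| * #|W|)%N.
Proof.
move=> aP; have [[_ [cXY _] _ _ _] _ _ _] := aP.
apply: (@leq_trans #|[set [set x; y] | x in W, y in averts P]|).
  apply/subset_leq_card/subsetP => e; rewrite inE => /andP[eP].
  have := aedge_sub aP eP; have /eqP/cards2P[x [y [xy eE]]] := aedge_card aP eP.
  rewrite eE subUset !sub1set => /andP[xV yV] /pred0Pn[z /andP[]] /=.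
  rewrite !inE => /orP[] /eqP-> zW; first by apply/imset2P; exists x y.
  by apply/imset2P; exists y x => //; rewrite setUC.
rewrite curry_imset2X (leq_trans (leq_imset_card _ _)) // cardsX mulnC.
rewrite leq_mul2r (leq_trans (leq_card_setU _ _)) ?orbT //.
by rewrite -cXY addnn mul2n.
Qed.

Lemma atom_cutd (c : R) P : is_atom P -> (3 <= L)%N -> 0 < J -> (0 < d)%N ->
  0 <= c -> c <= theta / J ^+ 2 -> c <= alpha / J ->
  cut_dense_on c (aedges P) (averts P).
Proof.
move=> [gp ha hJ _] L3 J0 d0 c0 hc1 hc2.
by apply: (good_pair_cutd L3 J0 _ c0 gp ha hJ hc1 hc2); rewrite ltr0n.
Qed.

Lemma width_le_lside P : is_atom P -> (L * width P <= #|lside P|)%N.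
Proof. by case=> gp _ _ _; exact: good_pair_width gp. Qed.

(** A side has at least [3 * width P] vertices, and one of them has fewer than [width P] outside
    [Z]. *)
Lemma atom_overlap P Z : is_atom P -> (3 <= L)%N -> nearly_inside P Z ->
  alpha * d%:R <= #|averts P :&: Z|%:R.
Proof.
move=> aP L3 nZ; have [[_ [cXY _] _ _ _] hw _ _] := aP.
apply: le_trans hw _; rewrite ler_nat.
have h : (2 * width P <= #|lside P|)%N.
  by apply: leq_trans (width_le_lside aP); rewrite leq_mul2r (ltnW L3) orbT.
have main (S : {set T}) : S \subset averts P -> #|S| = #|lside P| ->
    (#|S :\: Z| < width P)%N -> (width P <= #|averts P :&: Z|)%N.
  move=> sS cS hS; apply: (@leq_trans #|S :&: Z|); last by rewrite subset_leq_card // setSI.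
  rewrite -(leq_add2r #|S :\: Z|) cardsID cS; apply: leq_trans h.
  by rewrite mul2n -addnn leq_add2l ltnW.
case/orP: nZ; first by apply: main; rewrite ?subsetUl.
by apply: main; rewrite ?subsetUr.
Qed.

(* [W] is the part outside [Z] of the side that lies nearly inside [Z]: every
   vertex of the other side has many neighbours in the rest of that side. *)
Lemma nearly_inside_lost P Z : is_atom P -> (3 <= L)%N -> nearly_inside P Z ->
  exists W : {set T}, (#|W| < width P)%N /\
    forall e, e \in aedges P -> [disjoint e & W] ->
      [/\ e :&: Z != set0 & forall v, v \in e -> v \notin Z ->
           (width P <= degree (eadj (aedges P)) v Z)%N].
Proof.
move=> aP L3 nZ; have [[dXY [cXY _] degX degY _] _ _ eP] := aP.
have main (A B : {set T}) : (#|A :\: Z| < width P)%N ->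
    (forall e, e \in aedges P -> exists x y, [/\ x \in A, y \in B & e = [set x; y]]) ->
    (forall y, y \in B -> (L * width P <= degree (eadj (aedges P)) y A)%N) ->
    exists W : {set T}, (#|W| < width P)%N /\
    forall e, e \in aedges P -> [disjoint e & W] ->
      [/\ e :&: Z != set0 & forall v, v \in e -> v \notin Z ->
           (width P <= degree (eadj (aedges P)) v Z)%N].
  move=> hA hE hB; exists (A :\: Z); split=> // e /hE[x [y [xA yB ->]]] dW.
  have xZ : x \in Z.
    by have := disjointFr dW (set21 x y); rewrite inE xA andbT => /negbFE.
  split; first by apply/set0Pn; exists x; rewrite !inE eqxx.
  move=> v; rewrite !inE => /orP[] /eqP->; first by rewrite xZ.
  move=> _; have h1 := hB y yB.
  have h2 := degreeD (eadj (aedges P)) y A Z.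
  rewrite -(leq_add2r #|A :\: Z|) (leq_trans _ (leq_trans h1 h2)) //.
  apply: (@leq_trans (2 * width P)); first by rewrite mul2n -addnn leq_add2l ltnW.
  by rewrite leq_mul2r (ltnW L3) orbT.
case/orP: nZ => h; [apply: main h _ degY|apply: main h _ degX] => e.
  by move=> /(subsetP eP)/imset2P[x y xX yY ->]; exists x, y.
by move=> /(subsetP eP)/imset2P[x y xX yY ->]; exists y, x; rewrite setUC.
Qed.

End Atoms.

(** * Atoms and regular subgraphs in dense sets *)

Lemma exists_atom (R : realType) (J delta : R) (L : nat) :
  0 < J -> 0 < delta -> (0 < L)%N ->
  exists alpha theta : R, [/\ 0 < alpha, 0 < theta & exists d0 : nat,
  forall d, (d0 <= d)%N -> forall (T : finType) (E : {set {set T}}) (S : {set T}),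
  (forall e, e \in E -> #|e| = 2) -> #|S|%:R <= J * d%:R ->
  delta * d%:R ^+ 2 <= (npairs (eadj E) S S)%:R ->
  exists P : atom T, is_atom J alpha theta L d P /\ aedges P \subset E].
Proof.
move=> J0 delta0 L0; have [alpha [theta [a0 t0 [d0 hd]]]] := dense_good_pair L J0 delta0.
exists alpha, theta; split=> //; exists d0 => d dd T E S E2 cS eS.
have [X [Y [b [XS YS ab gp]]]] := hd d dd T (eadj E) S (eadj_sym E) (eadj_irr E2) cS eS.
pose F := E :&: bip_edges X Y.
have bT : (b < #|T|.+1)%N.
  have := good_pair_width gp => h; rewrite ltnS (leq_trans _ (max_card X)) //.
  by apply: leq_trans h; rewrite leq_pmull.
exists (X, Y, F, Ordinal bT); rewrite subsetIl; split=> //; split=> //=.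
- apply: good_pair_transfer gp; try exact: eadj_sym.
  move=> x y xX yY; rewrite /eadj [in RHS]in_setI.
  by rewrite (_ : _ \in bip_edges X Y) ?andbT //; exact: imset2_f.
- by apply: le_trans cS; rewrite ler_nat subset_leq_card // subUset XS.
- exact: subsetIr.
Qed.

Lemma exists_regular_on (R : realType) (J delta : R) : 0 < J -> 0 < delta ->
  exists2 q : R, 0 < q & exists d0 : nat,
  forall d, (d0 <= d)%N -> forall (T : finType) (E : {set {set T}}) (S : {set T}),
  (forall e, e \in E -> #|e| = 2) -> #|S|%:R <= J * d%:R ->
  delta * d%:R ^+ 2 <= (npairs (eadj E) S S)%:R ->
  exists (F : {set {set T}}) (V : {set T}), [/\ F \subset E, V \subset S, q * d%:R <= #|V|%:R
    & regular_on (Num.truncn (q * d%:R)) F V].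
Proof.
move=> J0 delta0; have [alpha [theta [a0 t0 [d0 hd]]]] := dense_good_pair 3 J0 delta0.
(* The first bound keeps the degree [k] below the scale of the pair, the second keeps the edges of
   [k] perfect matchings below [theta * d ^ 2]. *)
pose q := Num.min alpha (theta / (2 * J)).
have q0 : 0 < q by rewrite lt_min a0 divr_gt0 // mulr_gt0.
exists q => //; exists d0.+1 => d dd T E S E2 cS eS.
have D0 : 0 < d%:R :> R by rewrite ltr0n (leq_trans _ dd).
have [X [Y [b [XS YS ab gp]]]] :=
  hd d (ltnW dd) T (eadj E) S (eadj_sym E) (eadj_irr E2) cS eS.
set k := Num.truncn _.
have kq : k%:R <= q * d%:R by rewrite truncn_le mulr_ge0 // ltW.
have kb : (k <= b)%N.
  rewrite -(ler_nat R) (le_trans kq) // (le_trans _ ab) // ler_wpM2r ?(ltW D0) //.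
  by rewrite ge_min lexx.
have b0 : (0 < b)%N by rewrite -(ltr0n R) (lt_le_trans _ ab) // mulr_gt0.
have cX : #|X|%:R <= J * d%:R by rewrite (le_trans _ cS) // ler_nat subset_leq_card.
have kX : k%:R * #|X|%:R < theta * d%:R ^+ 2.
  apply: le_lt_trans (_ : theta / (2 * J) * d%:R * (J * d%:R) < _).
    apply: ler_pM => //; rewrite (le_trans kq) // ler_wpM2r ?(ltW D0) //.
    by rewrite ge_min lexx orbT.
  rewrite (_ : _ * _ = theta * d%:R ^+ 2 / 2); last by field; rewrite gt_eqF.
  by rewrite ltr_pdivrMr // ltr_pMr ?mulr_gt0 ?exprn_gt0 // ltr1n.
have [F FE kF] := good_pair_regular_on gp b0 kb kX.
exists F, (X :|: Y); split=> //; first by rewrite subUset XS.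
have [_ [_ /card_gt0P[x xX]] _ _ _] := gp.
have xV : x \in X :|: Y by rewrite inE xX.
(* A vertex and its [k] neighbours already make [k.+1] vertices, more than [q * d]. *)
apply: ltW; apply: lt_le_trans (truncnS_gt _) _; rewrite -/k ler_nat.
rewrite (cardsD1 x) xV add1n ltnS -((kF.2) x xV).
apply/subset_leq_card/subsetP => y; rewrite !inE => /andP[-> xy].
rewrite andbT; apply: contraTneq xy => ->.
by apply/negP => /(subsetP FE); apply/negP; rewrite -/(eadj E x x) eadj_irr.
Qed.

(** * Extremal families of finite sets *)

(** Greedy choice. Only nonempty sets are chosen, so that each choice shrinks [E]; maximality
    accordingly says that a further candidate is empty. *)
Lemma maximal_disjoint_family (I U : finType) (f : I -> {set U}) (p : I -> Prop)
    (E : {set U}) :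
  exists H : {set I}, [/\ forall i, i \in H -> [/\ p i, f i \subset E & f i != set0],
    {in H &, forall i j, i != j -> [disjoint f i & f j]}
  & forall i, p i -> f i \subset E :\: \bigcup_(j in H) f j -> f i = set0].
Proof.
move: {2}#|E| (leqnn #|E|) => n; elim: n E => [|n IHn] E En;
  (have [[i [pi iE i0]]|no] := pselect (exists i, [/\ p i, f i \subset E & f i != set0]);
  last first; [exists set0; split; [by move=> i; rewrite inE|by move=> i j; rewrite inE|]|]).
- rewrite big_set0 setD0 => i pi iE; apply/eqP; apply: contra_notT no => i0.
  by exists i.
- move: En; rewrite leqn0 cards_eq0 => /eqP E0.
  by move: iE; rewrite E0 subset0 (negPf i0).
- rewrite big_set0 setD0 => i pi iE; apply/eqP; apply: contra_notT no => i0.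
  by exists i.
have [|H [Hp Hd Hm]] := IHn (E :\: f i).
  rewrite -ltnS (leq_trans _ En) // cardsD (setIidPr iE) ltn_subrL card_gt0 i0 /=.
  by rewrite (leq_trans _ (subset_leq_card iE)) // card_gt0.
have dis j : j \in H -> [disjoint f j & f i].
  move=> /Hp[_ jE _]; rewrite disjoints_subset; apply: subset_trans jE _.
  by apply/subsetP => x; rewrite !inE => /andP[].
exists (i |: H); split.
- move=> j /setU1P[-> //|jH]; have [pj jE j0] := Hp j jH; split=> //.
  by apply: subset_trans jE _; rewrite subsetDl.
- move=> j k /setU1P[->|jH] /setU1P[->|kH] jk; rewrite ?eqxx // in jk *.
  + by rewrite disjoint_sym dis.
  + exact: dis.
  + exact: Hd.
- move=> j pj jE; apply: Hm => //; apply: subset_trans jE _.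
  have iH : i \notin H.
    apply/negP => /dis; rewrite -setI_eq0 setIid => fi0; by rewrite fi0 in i0.
  by rewrite big_setU1 //= setDDl.
Qed.

(** Start from singletons and merge two blocks while their union is good; each merger lowers the
    number of blocks. *)
Lemma minimal_merging (I : finType) (good : {set I} -> Prop) (A : {set I}) :
  (forall x, x \in A -> good [set x]) ->
  exists S : {set {set I}}, [/\ \bigcup_(B in S) B = A,
    {in S &, forall B C : {set I}, B != C -> [disjoint B & C]},
    forall B, B \in S -> good B
  & {in S &, forall B C : {set I}, B != C -> ~ good (B :|: C)}].
Proof.
move=> good1.
have start : exists S : {set {set I}}, [/\ \bigcup_(B in S) B = A,
    {in S &, forall B C : {set I}, B != C -> [disjoint B & C]} & forall B, B \in S -> good B].
  exists [set [set x] | x in A]; split.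
  - apply/setP => y; apply/bigcupP/idP => [[B /imsetP[x xA ->] /set1P-> //]|yA].
    by exists [set y]; rewrite ?inE // imset_f.
  - move=> _ _ /imsetP[x _ ->] /imsetP[y _ ->] xy.
    rewrite disjoints1 inE; apply: contra xy => /eqP->; exact: eqxx.
  - by move=> _ /imsetP[x xA ->]; exact: good1.
have [S [cS dS gS]] := start.
move: {2}#|S| (leqnn #|S|) => n; elim: n S cS dS gS => [|n IHn] S cS dS gS Sn;
  (have [[B [C [BS CS BC gBC]]]|no] := pselect (exists B C : {set I},
    [/\ B \in S, C \in S, B != C & good (B :|: C)]);
  last by (exists S; split=> // B C BS CS BC gBC; apply: no; exists B, C)).
  by move: Sn; rewrite leqn0 cards_eq0 => /eqP S0; rewrite S0 inE in BS.
have CSB : C \in S :\ B by rewrite !inE eq_sym BC CS.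
apply: (IHn ((B :|: C) |: (S :\ B :\ C))).
- rewrite -cS; apply/setP => x; apply/bigcupP/bigcupP => [[D]|[D DS xD]].
    case/setU1P => [->|]; last by rewrite !inE => /and3P[_ _ DS]; exists D.
    by rewrite inE => /orP[]; [exists B|exists C].
  have [DB|DB] := eqVneq D B; first by exists (B :|: C); rewrite ?inE ?eqxx // -DB xD.
  have [DC|DC] := eqVneq D C; first by exists (B :|: C); rewrite ?inE ?eqxx // -DC xD orbT.
  by exists D; rewrite // !inE DB DC DS orbT.
- have dU D : D \in S :\ B :\ C -> [disjoint B :|: C & D].
    rewrite !inE => /and3P[DC DB DS]; rewrite disjoints_subset subUset.
    by rewrite -!disjoints_subset !dS // eq_sym.
  move=> D D' /setU1P[->|hD] /setU1P[->|hD'] DD'; rewrite ?eqxx // in DD' *.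
  + exact: dU.
  + by rewrite disjoint_sym dU.
  + by move: hD hD'; rewrite !inE => /and3P[_ _ ?] /and3P[_ _ ?]; exact: dS.
- by move=> D /setU1P[-> //|]; rewrite !inE => /and3P[_ _ /gS].
- rewrite -ltnS (leq_trans _ Sn) // (cardsD1 B S) BS (cardsD1 C (S :\ B)) CSB.
  by rewrite !add1n ltnS cardsU1; case: (_ \notin _) => //; rewrite add0n.
Qed.

Definition shared (I T : finType) (V : I -> {set T}) (A : {set I}) (i : I) : {set T} :=
  [set v in V i | [exists j in A, (j != i) && (v \in V j)]].

(** When [i] is taken out, [D i] is [V i] without the vertices shared with the sets still present.
    It is thus disjoint from each of these, hence from every [D j] defined later. *)
Lemma peel_lightly_shared (I T : finType) (V : I -> {set T}) (small : pred nat)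
    (A : {set I}) :
  exists B : {set I}, exists D : I -> {set T}, [/\ B \subset A,
    forall i, i \in B -> ~~ small #|shared V B i|,
    forall i, i \in A :\: B -> D i \subset V i /\ small #|V i :\: D i|
  & {in A :\: B &, forall i j, i != j -> [disjoint D i & D j]}].
Proof.
move: {2}#|A| (leqnn #|A|) => n; elim: n A => [|n IHn] A An;
  (case: (pickP (fun i => (i \in A) && small #|shared V A i|)) => [i /andP[iA si]|no];
  last by (exists A, (fun _ => set0); rewrite setDv; split=> // i; rewrite ?inE // => iA;
    have := no i; rewrite iA => /negbT)).
  by move: An; rewrite leqn0 cards_eq0 => /eqP A0; rewrite A0 inE in iA.
have [|B [D [sB hB hD dD]]] := IHn (A :\ i).
  by move: An; rewrite (cardsD1 i A) iA.
have iB : i \notin B by apply/negP => /(subsetP sB); rewrite !inE eqxx.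
exists B, (fun j => if j == i then V i :\: shared V A i else D j).
have inAB j : j \in A :\: B -> j != i -> j \in (A :\ i) :\: B.
  by rewrite !inE => /andP[-> ->] ->.
have dV j : j \in A -> j != i -> [disjoint V i :\: shared V A i & V j].
  move=> jA ji; rewrite disjoints_subset; apply/subsetP => v; rewrite !inE.
  case/andP=> + vi; rewrite vi /=; apply: contra => vj.
  by apply/existsP; exists j; rewrite jA ji.
split=> //.
- by rewrite (subset_trans sB) // subD1set.
- move=> j jAB; case: eqP => [->|/eqP ji]; last exact/hD/inAB.
  split; first exact: subsetDl.
  by rewrite setDDr setDv set0U (setIidPr _) //; apply/subsetP => v; rewrite inE => /andP[].
- move=> j k jAB kAB jk; case: ifPn => [/eqP ji|ji]; case: ifPn => [/eqP ki|ki].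
  + by rewrite ji ki eqxx in jk.
  + have kA : k \in A by move: kAB; rewrite inE => /andP[].
    by apply: disjointWr (dV k kA ki); have [] := hD k (inAB k kAB ki).
  + have jA : j \in A by move: jAB; rewrite inE => /andP[].
    rewrite disjoint_sym.
    by apply: disjointWr (dV j jA ji); have [] := hD j (inAB j jAB ji).
  + by apply: dD => //; exact: inAB.
Qed.

Lemma sum_card_disjoint (I U : finType) (f : I -> {set U}) (A : {set I}) :
  {in A &, forall i j, i != j -> [disjoint f i & f j]} ->
  (\sum_(i in A) #|f i| <= #|\bigcup_(i in A) f i|)%N.
Proof.
move=> dis; set V := \bigcup_(i in A) f i.
have fE i : i \in A -> #|f i| = (\sum_(x in V) (x \in f i))%N.
  move=> iA; rewrite -big_mkcondr sum1dep_card; apply: eq_card => x; rewrite inE.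
  apply/idP/andP => [xf|[] //]; split=> //; apply/bigcupP; by exists i.
rewrite (eq_bigr _ fE) exchange_big /= -[leqRHS]sum1_card; apply: leq_sum => x _.
rewrite -big_mkcondr sum1dep_card; apply/card_le1_eqP => i j.
rewrite !inE => /andP[iA xi] /andP[jA xj]; apply/eqP.
apply: contraLR isT => ij; have := disjointFr (dis j i jA iA ij) xj.
by rewrite xi.
Qed.

(** * Clusters *)

Lemma regular_onU (T : finType) k (F F' : {set {set T}}) (W W' : {set T}) :
  [disjoint W & W'] -> regular_on k F W -> regular_on k F' W' ->
  regular_on k (F :|: F') (W :|: W').
Proof.
move=> dW [FW kW] [FW' kW']; split=> [e|v].
  by rewrite inE => /orP[/FW|/FW'] h; rewrite (subset_trans h) ?subsetUl ?subsetUr.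
have adjW (G : {set {set T}}) (V : {set T}) x y :
    (forall e, e \in G -> e \subset V) -> eadj G x y -> (x \in V) && (y \in V).
  by move=> GV /GV; rewrite subUset !sub1set.
have nW z : z \in W -> z \in W' -> False.
  by move=> zW; rewrite (disjointFr dW zW).
rewrite inE => /orP[vW|vW].
  rewrite -(kW v vW); apply: eq_card => y; rewrite !inE /eadj inE.
  apply/andP/andP => [[_ /orP[h|h]]|[-> ->] //].
    by have /andP[] := adjW _ _ _ _ FW h.
  by have /andP[/(nW v vW)] := adjW _ _ _ _ FW' h.
rewrite -(kW' v vW); apply: eq_card => y; rewrite !inE /eadj inE.
apply/andP/andP => [[_ /orP[h|h]]|[-> ->]]; last by rewrite !orbT.
  by have /andP[/nW/(_ vW)] := adjW _ _ _ _ FW h.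
by have /andP[] := adjW _ _ _ _ FW' h.
Qed.

Section Clusters.
Variables (R : realType) (T : finType) (E : {set {set T}}).
Variables (C J q alpha theta c0 rho M zeta : R) (L Lc d k : nat).
Implicit Types (S : {set atom T}) (P : atom T) (Z W U : {set T}).
Implicit Types (K F : {set {set T}}).

Let D : R := d%:R.

Definition sedges S : {set {set T}} := \bigcup_(P in S) aedges P.

Definition attached F Z : {set T} := [set u | alpha * D <= (degree (eadj F) u Z)%:R].

Definition hull S Z : {set T} := Z :|: attached (sedges S) Z.

(** Loss of cut-density when [x * D] common vertices are attached to two cores
    ([cut_dense_on_attach]) and the cores are then united along them ([cut_dense_on_union]). A rise
    in level adds one union with an atom that overlaps in [alpha * D] vertices. *)
Definition merge_factor (x : R) : R := alpha ^+ 2 / (4 * M ^+ 2) * (x / (4 * M)).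

Definition level_factor : R := merge_factor zeta * (alpha / (4 * M)).

(* A cluster is a set [S] of atoms together with a bounded cut-dense vertex set
   [Z] which meets all of them. Its level [i] bounds from below the order of a
   regular graph [K] found inside [Z]; the loss in cut-density is one
   [level_factor] per level, so it does not depend on the number of mergers. *)
Definition core S Z (beta m : R) (i : nat) W K : Prop :=
  [/\ [/\ forall P, P \in S -> is_atom J alpha theta L d P /\ aedges P \subset E,
          exists2 P, P \in S & averts P \subset Z
        & forall P, P \in S -> alpha * D <= #|averts P :&: Z|%:R],
      cut_dense_on beta (sedges S) Z,
      #|Z|%:R <= m * D,
      [/\ regular_on k K W, K \subset sedges S & W \subset Z]
    & i%:R * (q * D) <= #|W|%:R].

(** [c0] is the cut-density of a single atom. A rise in level unites at most two cores, [2 * d]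
    common vertices and one atom on [J * d] vertices; since the earlier bound is at least [J + 2],
    tripling it pays for all of these. *)
Definition cluster S Z (i : nat) W K : Prop :=
  core S Z (c0 * level_factor ^+ i) ((J + 2) * 3 ^+ i) i W K.

Hypothesis d_gt0 : (0 < d)%N.
Hypothesis L_ge3 : (3 <= L)%N.
Hypothesis J_gt0 : 0 < J.
Hypothesis alpha_gt0 : 0 < alpha.
Hypothesis alphaM : alpha <= M.
Hypothesis c0_gt0 : 0 < c0.
Hypothesis c0_le1 : c0 <= 1.
Hypothesis c0_theta : c0 <= theta / J ^+ 2.
Hypothesis c0_alpha : c0 <= alpha / J.
Hypothesis zeta_gt0 : 0 < zeta.
Hypothesis zeta_le1 : zeta <= 1.
(** [M * d] bounds [Lc.+1] cores together with [2 * d] common vertices each; a regular graph of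
    level [Lc] would have order [C * d]; and [Lc] overlaps of order [zeta * d] stay within the width
    of an atom. *)
Hypothesis M_big : Lc.+1%:R * ((J + 2) * 3 ^+ Lc + 2) <= M.
Hypothesis Lc_big : C <= Lc%:R * q.
Hypothesis Lc_zeta : Lc%:R * zeta <= alpha.
Hypothesis rho_small : rho <= c0 * level_factor ^+ Lc.

Hypothesis extraction : forall P W, is_atom J alpha theta L d P ->
  ~~ nearly_inside P W -> exists (F : {set {set T}}) (V : {set T}),
    [/\ F \subset aedges P, V \subset averts P, [disjoint W & V], q * D <= #|V|%:R & regular_on k F V].

Hypothesis core_free : forall F Z K W, F \subset E -> cut_dense_on rho F Z ->
  #|Z|%:R <= M * D -> K \subset F -> W \subset Z -> regular_on k K W ->
  #|W|%:R < C * D.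

Let D_gt0 : 0 < D. Proof. by rewrite ltr0n. Qed.

Let M_gt0 : 0 < M. Proof. exact: lt_le_trans alphaM. Qed.

Let m_gt0 i : 0 < (J + 2) * 3 ^+ i :> R.
Proof. by rewrite mulr_gt0 ?exprn_gt0 // addr_gt0. Qed.

Let m_ge i : J + 2 <= (J + 2) * 3 ^+ i.
Proof. by rewrite ler_peMr ?exprn_ege1 ?ler1n // addr_ge0 // ltW. Qed.

Let m_leM i : (i <= Lc)%N -> (J + 2) * 3 ^+ i + 2 <= M.
Proof.
move=> iL; apply: le_trans M_big.
apply: le_trans (_ : (J + 2) * 3 ^+ Lc + 2 <= _).
  by rewrite lerD2r ler_wpM2l ?addr_ge0 ?(ltW J_gt0) // ler_weXn2l // ler1n.
by rewrite ler_peMl ?ler1n // addr_ge0 // ltW.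
Qed.

Lemma half_factor_le1 : alpha ^+ 2 / (4 * M ^+ 2) <= 1.
Proof.
rewrite ler_pdivrMr ?mulr_gt0 ?exprn_gt0 // mul1r.
have : alpha ^+ 2 <= M ^+ 2 by rewrite lerXn2r // nnegrE ltW.
have : 0 <= M ^+ 2 by rewrite exprn_ge0 // ltW.
by lra.
Qed.

Lemma half_factor_gt0 : 0 < alpha ^+ 2 / (4 * M ^+ 2).
Proof. by rewrite divr_gt0 ?mulr_gt0 ?exprn_gt0. Qed.

Lemma ratio_le1 x : x <= M -> x / (4 * M) <= 1.
Proof. by move=> xM; rewrite ler_pdivrMr ?mulr_gt0 // mul1r; have := M_gt0; lra. Qed.

Lemma ratio_gt0 x : 0 < x -> 0 < x / (4 * M).
Proof. by move=> x0; rewrite divr_gt0 // mulr_gt0. Qed.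

Lemma one_leM : 1 <= M.
Proof. by apply: le_trans (m_leM (leq0n Lc)); rewrite expr0; have := J_gt0; lra. Qed.

Lemma merge_factor_gt0 x : 0 < x -> 0 < merge_factor x.
Proof. by move=> x0; rewrite mulr_gt0 ?half_factor_gt0 ?ratio_gt0. Qed.

Lemma merge_factor_le1 x : 0 < x -> x <= 1 -> merge_factor x <= 1.
Proof.
move=> x0 x1; apply: mulr_ile1.
- exact/ltW/half_factor_gt0.
- exact/ltW/ratio_gt0.
- exact: half_factor_le1.
- exact/ratio_le1/(le_trans x1)/one_leM.
Qed.

Lemma level_factor_gt0 : 0 < level_factor.
Proof. by rewrite mulr_gt0 ?merge_factor_gt0 ?ratio_gt0. Qed.

Lemma level_factor_le1 : level_factor <= 1.
Proof.
apply: mulr_ile1; last exact: ratio_le1.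
- exact/ltW/merge_factor_gt0.
- exact/ltW/ratio_gt0.
- exact: merge_factor_le1.
Qed.

(** The hulls may meet only outside the cores. The common vertices [U] are attached to both cores
    first, which makes these overlap in [U]. *)
Lemma cut_dense_on_merge (beta x : R) F F' Z Z' U :
  0 <= beta -> beta <= 1 -> 0 < x ->
  cut_dense_on beta F Z -> cut_dense_on beta F' Z' ->
  alpha * D <= #|Z|%:R -> alpha * D <= #|Z'|%:R ->
  U \subset Z :|: attached F Z -> U \subset Z' :|: attached F' Z' ->
  x * D <= #|U|%:R -> #|Z :|: Z' :|: U|%:R <= M * D ->
  cut_dense_on (beta * merge_factor x) (F :|: F') (Z :|: Z' :|: U).
Proof.
move=> beta0 beta1 x0 cZ cZ' hZ hZ' /subsetP UZ /subsetP UZ' hU hM.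
have part G V : cut_dense_on beta G V -> alpha * D <= #|V|%:R ->
    (forall u, u \in U -> u \in V :|: attached G V) -> V \subset Z :|: Z' ->
    cut_dense_on (beta * (alpha ^+ 2 / (4 * M ^+ 2))) G (V :|: U).
  move=> cV hV aV sV; apply: (@cut_dense_on_attach _ _ _ _ _ D) => //.
    by move=> u /aV; rewrite !inE => /orP[->|].
  apply: le_trans hM; rewrite ler_nat subset_leq_card // subUset subsetUr andbT.
  by rewrite (subset_trans sV) // subsetUl.
rewrite /merge_factor mulrA (_ : Z :|: Z' :|: U = (Z :|: U) :|: (Z' :|: U)); last first.
  by rewrite setUACA setUid.
apply: (@cut_dense_on_union _ _ _ _ _ D) => //.
- exact/mulr_ge0/ltW/half_factor_gt0.
- exact: ltW.
- exact: cut_dense_onW (lexx _) (subsetUl _ _) (part F Z cZ hZ UZ (subsetUl _ _)).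
- exact: cut_dense_onW (lexx _) (subsetUr _ _) (part F' Z' cZ' hZ' UZ' (subsetUr _ _)).
- apply: le_trans hU _; rewrite ler_nat subset_leq_card //.
  by rewrite subsetI !subsetUr.
- by rewrite setUACA setUid.
Qed.

Lemma sedges_sub S P : P \in S -> aedges P \subset sedges S.
Proof. by move=> PS; exact: bigcup_sup. Qed.

Lemma sedgesU S S' : sedges (S :|: S') = sedges S :|: sedges S'.
Proof. by rewrite /sedges bigcup_setU. Qed.

Lemma cluster_edges S Z i W K : cluster S Z i W K -> sedges S \subset E.
Proof. by case=> [[h _ _] _ _ _ _]; apply/bigcupsP => P /h[]. Qed.

Lemma cut_dense_on_level S Z i W K : cluster S Z i W K -> (i <= Lc)%N ->
  cut_dense_on (c0 * level_factor ^+ Lc) (sedges S) Z.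
Proof.
case=> _ cZ _ _ _ iL; apply: cut_dense_onW (subxx _) cZ; rewrite ler_wpM2l ?(ltW c0_gt0) //.
by rewrite ler_wiXn2l // ?level_factor_le1 // ltW // level_factor_gt0.
Qed.

Lemma cluster_size S Z i W K : cluster S Z i W K -> (i <= Lc)%N ->
  #|Z|%:R <= (J + 2) * 3 ^+ Lc * D.
Proof.
case=> _ _ hZ _ _ iL; apply: le_trans hZ _; rewrite ler_wpM2r ?(ltW D_gt0) //.
by rewrite ler_wpM2l ?addr_ge0 ?(ltW J_gt0) // ler_weXn2l // ler1n.
Qed.

(** Otherwise the core and its regular graph would be a further large regular core. This bound
    becomes the bound on the vertex covers in [G1]. *)
Lemma cluster_cover S Z i W K : cluster S Z i W K -> (i <= Lc)%N ->
  #|W|%:R < C * D.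
Proof.
move=> cl iL; have [_ _ _ [kK KS WZ] _] := cl.
have cZ := cut_dense_onW rho_small (subxx _) (cut_dense_on_level cl iL).
apply: core_free (cluster_edges cl) cZ _ KS WZ kK.
apply: le_trans (cluster_size cl iL) _; rewrite ler_wpM2r ?(ltW D_gt0) //.
by apply: le_trans (m_leM (leqnn Lc)); rewrite lerDl.
Qed.

(** At level [Lc] the regular graph would have order at least [C * d]. *)
Lemma cluster_level S Z i W K : cluster S Z i W K -> (i <= Lc)%N -> (i < Lc)%N.
Proof.
move=> cl iL; rewrite ltn_neqAle iL andbT; apply/eqP => iLc.
have := cluster_cover cl iL; have [_ _ _ _] := cl.
rewrite iLc => h1 h2; have := le_lt_trans h1 h2.
by rewrite mulrA ltr_pM2r // ltNge Lc_big.
Qed.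

Lemma cluster_core_size S Z i W K : cluster S Z i W K -> alpha * D <= #|Z|%:R.
Proof.
case=> [[atS [P PS PZ] ovS] _ _ _ _]; apply: le_trans (ovS P PS) _.
by rewrite ler_nat subset_leq_card // subsetIr.
Qed.

(** Level 0 starts from the empty graph, which is regular of every degree. *)
Lemma cluster1 P : is_atom J alpha theta L d P -> aedges P \subset E ->
  cluster [set P] (averts P) 0 set0 set0.
Proof.
move=> aP PE; have hov : alpha * D <= #|averts P :&: averts P|%:R.
  apply: (atom_overlap aP L_ge3); rewrite /nearly_inside.
  have /eqP-> : lside P :\: averts P == set0 by rewrite setD_eq0 subsetUl.
  have [_ hw _ _] := aP.
  by rewrite cards0 -(ltr0n R) (lt_le_trans _ hw) // mulr_gt0.
split.
- split=> [Q /set1P->|| Q /set1P->] //; first by exists P; rewrite ?inE.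
- rewrite expr0 mulr1 /sedges big_set1.
  by apply: atom_cutd aP L_ge3 J_gt0 d_gt0 (ltW c0_gt0) c0_theta c0_alpha.
- have [_ _ hJ _] := aP; apply: le_trans hJ _.
  by rewrite expr0 mulr1 ler_wpM2r ?(ltW D_gt0) // lerDl.
- by split; rewrite ?sub0set //; split=> x; rewrite inE.
- by rewrite mul0r.
Qed.

(** The regular graph extracted from [P] avoids [W], so its union with [K] is again regular. The
    parameters [beta] and [m] are free because a core that has just been merged lies between two
    levels. *)
Lemma core_grow S Z i W K P (beta m : R) :
  core S Z beta m i W K -> (i < Lc)%N ->
  m + J <= (J + 2) * 3 ^+ i.+1 -> 0 <= beta -> beta <= c0 ->
  c0 * level_factor ^+ i.+1 <= beta * (alpha / (4 * M)) ->
  P \in S -> ~~ nearly_inside P W ->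
  exists W' K', cluster S (Z :|: averts P) i.+1 W' K'.
Proof.
move=> cl iL mJ b0 bc0 hb PS nP.
have [[atS [P0 P0S P0Z] ovS] cZ hZ [kK KS WZ] hW] := cl.
have [aP PE] := atS P PS.
have [F [V [FP VP dWV hV kF]]] := extraction aP nP.
have hsize : #|Z :|: averts P|%:R <= (J + 2) * 3 ^+ i.+1 * D.
  apply: le_trans (_ : (m + J) * D <= _); last by rewrite ler_wpM2r ?(ltW D_gt0).
  apply: le_trans (_ : #|Z|%:R + #|averts P|%:R <= _).
    by rewrite -natrD ler_nat leq_card_setU.
  by have [_ _ hJ _] := aP; rewrite mulrDl lerD.
exists (W :|: V), (K :|: F); split.
- split=> //; first by exists P0; rewrite // (subset_trans P0Z) // subsetUl.
  move=> Q QS; apply: le_trans (ovS Q QS) _.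
  by rewrite ler_nat subset_leq_card // setIS // subsetUl.
- apply: cut_dense_onW hb (subxx _) _.
  apply: (@cut_dense_on_union _ _ _ _ _ D) => //; first exact: ltW.
  + have cP := atom_cutd aP L_ge3 J_gt0 d_gt0 (ltW c0_gt0) c0_theta c0_alpha.
    exact: cut_dense_onW bc0 (sedges_sub PS) cP.
  + by rewrite setIC; exact: ovS.
  + apply: le_trans hsize _; rewrite ler_wpM2r ?(ltW D_gt0) //.
    by apply: le_trans (m_leM iL); rewrite lerDl.
- exact: hsize.
- split; first exact: regular_onU.
    by rewrite subUset KS (subset_trans FP) // sedges_sub.
  by rewrite subUset (subset_trans WZ) ?subsetUl // (subset_trans VP) ?subsetUr.
- rewrite cardsU (disjoint_setI0 dWV) cards0 subn0 natrD -natr1 mulrDl mul1r.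
  exact: lerD.
Qed.

Definition saturated S W := forall P, P \in S -> nearly_inside P W.

(** Each atom that is not nearly inside [W] raises the level, and levels stay below [Lc]. *)
Lemma cluster_saturate S Z i W K : cluster S Z i W K -> (i < Lc)%N ->
  exists Z' i' W' K', [/\ cluster S Z' i' W' K', (i' < Lc)%N & saturated S W'].
Proof.
move: {2}(Lc - i)%N (leqnn (Lc - i)) => n.
elim: n Z i W K => [|n IHn] Z i W K hn cl iL.
  by rewrite leqn0 subn_eq0 leqNgt iL in hn.
case: (pickP (fun P => (P \in S) && ~~ nearly_inside P W))
  => [P /andP[PS nP]|sat]; last first.
  exists Z, i, W, K; split=> // P PS; have := sat P; rewrite PS /=.
  by move/negbFE.
have [_ cZ hZ _ _] := cl.
have th0 := level_factor_gt0; have th1 := level_factor_le1.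
have b0 : 0 <= c0 * level_factor ^+ i.
  by rewrite mulr_ge0 ?exprn_ge0 ?(ltW th0) ?(ltW c0_gt0).
have [|||W' [K' cl']] := core_grow cl iL _ b0 _ _ PS nP.
- by have := m_ge i; have := J_gt0; rewrite exprS; lra.
- rewrite ler_piMr ?(ltW c0_gt0) // exprn_ile1 // ltW //.
- rewrite exprSr mulrA ler_wpM2l // /level_factor ler_piMl //.
    exact/ltW/ratio_gt0.
  exact: merge_factor_le1.
have iL' := cluster_level cl' iL.
by apply: (IHn _ _ _ _ _ cl' iL'); rewrite -ltnS (leq_trans _ hn) // ltn_sub2l.
Qed.

(** Hulls may overlap in far more than order [d] vertices, but only boundedly many times [d] may
    enter a core. *)
Lemma overlap_witness (x : R) (H : {set T}) : 0 < x -> x <= 1 -> x * D < #|H|%:R ->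
  exists2 U : {set T}, U \subset H & x * D <= #|U|%:R /\ #|U|%:R <= 2 * D.
Proof.
move=> x0 x1 hx; have xD0 : 0 <= x * D by rewrite mulr_ge0 // ltW.
have [U sU cU] : exists2 U : {set T}, U \subset H & #|U| = (Num.truncn (x * D)).+1.
  by apply: exists_subset_card; rewrite truncn_lt_nat.
exists U => //; rewrite cU; split; first exact/ltW/truncnS_gt.
rewrite -natr1; have : (Num.truncn (x * D))%:R <= x * D by rewrite truncn_le.
have : x * D <= 1 * D by rewrite ler_wpM2r // ltW.
have : 1 <= D by rewrite ler1n.
lra.
Qed.

(* Let [i' <= i]. If some atom of the second cluster is not nearly inside [W],
   it yields a regular graph disjoint from [K], and the level increases. If not,
   every atom of the second cluster attaches to the core [Z] of the first one,
   which then absorbs it with no loss at all. *)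
Lemma cluster_merge S Z i W K S' Z' i' W' K' :
  cluster S Z i W K -> (i < Lc)%N -> cluster S' Z' i' W' K' -> (i' <= i)%N ->
  zeta * D < #|hull S Z :&: hull S' Z'|%:R ->
  exists Z'' i'' W'' K'', cluster (S :|: S') Z'' i'' W'' K'' /\ (i'' < Lc)%N.
Proof.
move=> cl iL cl' i'i hov.
have [[atS [P0 P0S P0Z] ovS] cZ hZ [kK KS WZ] hW] := cl.
have [[atS' _ ovS'] cZ' hZ' _ _] := cl'.
have atU P : P \in S :|: S' -> is_atom J alpha theta L d P /\ aedges P \subset E.
  by rewrite inE => /orP[/atS|/atS'].
case: (pickP (fun P => (P \in S') && ~~ nearly_inside P W))
  => [P /andP[PS' nP]|sat]; last first.
  exists Z, i, W, K; split=> //; split=> //.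
  - split=> //; first by exists P0; rewrite // inE P0S.
    move=> P; rewrite inE => /orP[/ovS //|PS'].
    have [aP _] := atS' P PS'; apply: (atom_overlap aP L_ge3).
    by apply: nearly_insideS WZ _; have := sat P; rewrite PS' => /negbFE.
  - by apply: cut_dense_onW (lexx _) _ cZ; rewrite sedgesU subsetUl.
  - by split=> //; rewrite sedgesU (subset_trans KS) // subsetUl.
have th0 := level_factor_gt0; have th1 := level_factor_le1.
have b0 : 0 <= c0 * level_factor ^+ i.
  by rewrite mulr_ge0 ?exprn_ge0 ?(ltW th0) ?(ltW c0_gt0).
have bc0 : c0 * level_factor ^+ i <= c0.
  by rewrite ler_piMr ?(ltW c0_gt0) // exprn_ile1 // ltW.
have [U sU [hU hU2]] := overlap_witness zeta_gt0 zeta_le1 hov.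
move: sU; rewrite subsetI => /andP[UZ UZ'].
pose Z1 := Z :|: Z' :|: U.
have hZ'i : #|Z'|%:R <= (J + 2) * 3 ^+ i * D.
  apply: le_trans hZ' _; rewrite ler_wpM2r ?(ltW D_gt0) //.
  by rewrite ler_wpM2l ?addr_ge0 ?(ltW J_gt0) // ler_weXn2l // ler1n.
have hZ1 : #|Z1|%:R <= (2 * ((J + 2) * 3 ^+ i) + 2) * D.
  apply: le_trans (_ : #|Z|%:R + #|Z'|%:R + #|U|%:R <= _); last by lra.
  rewrite -!natrD ler_nat (leq_trans (leq_card_setU _ _)) // leq_add2r.
  exact: leq_card_setU.
have m3 : 2 * ((J + 2) * 3 ^+ i) + 2 + J <= (J + 2) * 3 ^+ i.+1.
  by have := m_ge i; rewrite exprS; lra.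
have cZ'i : cut_dense_on (c0 * level_factor ^+ i) (sedges S') Z'.
  apply: cut_dense_onW (subxx _) cZ'; rewrite ler_wpM2l ?(ltW c0_gt0) //.
  by rewrite ler_wiXn2l // ltW.
have cZ1 : cut_dense_on (c0 * level_factor ^+ i * merge_factor zeta) (sedges (S :|: S')) Z1.
  rewrite sedgesU; apply: cut_dense_on_merge => //.
  - exact: le_trans bc0 c0_le1.
  - exact: cluster_core_size cl.
  - exact: cluster_core_size cl'.
  - apply: le_trans hZ1 _; rewrite ler_wpM2r ?(ltW D_gt0) //.
    by have := m_leM iL; have := J_gt0; lra.
have coreU : core (S :|: S') Z1 (c0 * level_factor ^+ i * merge_factor zeta)
    (2 * ((J + 2) * 3 ^+ i) + 2) i W K.
  have ZZ1 : Z \subset Z1 by rewrite /Z1 -setUA subsetUl.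
  have Z'Z1 : Z' \subset Z1 by rewrite /Z1 setUAC subsetUr.
  split=> //.
  - split=> //; first by exists P0; rewrite ?inE ?P0S // (subset_trans P0Z).
    move=> Q; rewrite inE => /orP[/ovS|/ovS'] h; apply: le_trans h _;
    by rewrite ler_nat subset_leq_card // setIS.
  - split=> //; last exact: subset_trans ZZ1.
    by rewrite sedgesU (subset_trans KS) // subsetUl.
have mf0 := merge_factor_gt0 zeta_gt0; have mf1 := merge_factor_le1 zeta_gt0 zeta_le1.
have PU : P \in S :|: S' by rewrite inE PS' orbT.
have [|||W2 [K2 cl2]] := core_grow coreU iL m3 _ _ _ PU nP.
- by rewrite mulr_ge0 // ltW.
- by apply: le_trans bc0; rewrite ler_piMr.
- by rewrite exprSr /level_factor !mulrA.
exists (Z1 :|: averts P), i.+1, W2, K2; split=> //.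
exact: cluster_level cl2 iL.
Qed.

(** * Families of clusters with small overlaps *)

Lemma attachedS F F' Z Z' :
  F \subset F' -> Z \subset Z' -> attached F Z \subset attached F' Z'.
Proof.
move=> sF sZ; apply/subsetP => u; rewrite !inE => /le_trans; apply.
by rewrite ler_nat (leq_trans (sub_degree _ _ (eadjS sF))) // degreeS.
Qed.

(** [good] quantifies over all cores of a set of atoms, so minimality excludes mergers for every
    choice of cores; the cores can therefore be saturated after merging has stopped. *)
Lemma cluster_family (A : {set atom T}) :
  (forall P, P \in A -> is_atom J alpha theta L d P /\ aedges P \subset E) ->
  exists (SS : {set {set atom T}}) (z w : {set atom T} -> {set T}),
  [/\ \bigcup_(S in SS) S = A,
    {in SS &, forall S S' : {set atom T}, S != S' -> [disjoint S & S']},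
    forall S, S \in SS -> exists i K,
      [/\ cluster S (z S) i (w S) K, (i < Lc)%N & saturated S (w S)]
  & {in SS &, forall S S' : {set atom T}, S != S' ->
      #|hull S (z S) :&: hull S' (z S')|%:R <= zeta * D}].
Proof.
move=> atA; pose good S := exists Z i W K, cluster S Z i W K /\ (i < Lc)%N.
have [P PA|SS [cA dA gA nA]] := @minimal_merging _ good A.
  have [aP PE] := atA P PA; have cl := cluster1 aP PE.
  by exists (averts P), 0, set0, set0; split; rewrite ?(cluster_level cl).
have [|zw hzw] := @choice _ _ (fun S (zw : {set T} * {set T}) => S \in SS -> exists i K,
    [/\ cluster S zw.1 i zw.2 K, (i < Lc)%N & saturated S zw.2]).
  move=> S; have [SSS|_] := boolP (S \in SS); last by exists (set0, set0).
  have [Z [i [W [K [cl iL]]]]] := gA S SSS.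
  have [Z' [i' [W' [K' [cl' iL' sat]]]]] := cluster_saturate cl iL.
  by exists (Z', W') => _; exists i', K'.
exists SS, (fun S => (zw S).1), (fun S => (zw S).2); split=> // S S' hS hS' SS'.
rewrite leNgt; apply/negP => hov; apply: (nA S S' hS hS' SS').
have [i [K [cl iL _]]] := hzw S hS; have [i' [K' [cl' iL' _]]] := hzw S' hS'.
have [i'i|/ltnW ii'] := leqP i' i.
  have [Z'' [i'' [W'' [K'' h]]]] := cluster_merge cl iL cl' i'i hov.
  by exists Z'', i'', W'', K''.
rewrite setIC in hov.
have [Z'' [i'' [W'' [K'' h]]]] := cluster_merge cl' iL' cl ii' hov.
by exists Z'', i'', W'', K''; rewrite setUC.
Qed.

(* The cores of clusters with pairwise small overlap contain almost disjoint
   atoms, hence disjoint regular graphs. *)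
Lemma overlap_core (gamma : R) S Z i W0 K0 (z : {set atom T} -> {set T})
    (l : seq {set atom T}) :
  0 < gamma -> gamma <= 1 -> cluster S Z i W0 K0 -> (i < Lc)%N ->
  {in l, forall S', exists i W K, cluster S' (z S') i W K /\ (i < Lc)%N} ->
  {in l, forall S', gamma * D < #|hull S Z :&: hull S' (z S')|%:R} ->
  {in l &, forall S1 S2, S1 != S2 -> #|z S1 :&: z S2|%:R <= zeta * D} ->
  uniq l -> (size l <= Lc)%N ->
  exists (F : {set {set T}}) (V : {set T}) (K : {set {set T}}) (W : {set T}),
  [/\ cut_dense_on (c0 * level_factor ^+ Lc * merge_factor gamma ^+ size l) F V,
    [/\ F \subset E, sedges S \subset F & Z \subset V],
    #|V|%:R <= (size l).+1%:R * ((J + 2) * 3 ^+ Lc + 2) * D,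
    [/\ regular_on k K W, K \subset F, W \subset V & W \subset \bigcup_(S' <- l) z S']
  & (size l)%:R * (q * D) <= #|W|%:R].
Proof.
move=> g0 g1 cl iL; have mf0 := merge_factor_gt0 g0; have mf1 := merge_factor_le1 g0 g1.
have lf0 := level_factor_gt0; have lf1 := level_factor_le1.
elim: l => [|S' l IHl] hcl hov hzz ul sl.
  exists (sedges S), Z, set0, set0; split.
  - by rewrite expr0 mulr1; exact: cut_dense_on_level cl (ltnW iL).
  - by split=> //; exact: cluster_edges cl.
  - apply: le_trans (cluster_size cl (ltnW iL)) _.
    by rewrite mul1r ler_wpM2r ?(ltW D_gt0) // lerDl.
  - by split; rewrite ?sub0set //; split=> x; rewrite inE.
  - by rewrite mul0r.
have [S'l {}ul] := andP ul.
have [|||||F [V [K [W [cV [FE SF ZV] hV [kK KF WV Wl] hW]]]]] := IHl.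
- by move=> X Xl; apply: hcl; rewrite inE Xl orbT.
- by move=> X Xl; apply: hov; rewrite inE Xl orbT.
- by move=> X Y Xl Yl; apply: hzz; rewrite inE ?Xl ?Yl orbT.
- by [].
- exact: ltnW.
have S'in : S' \in S' :: l by rewrite inE eqxx.
have [i' [W' [K' [cl' iL']]]] := hcl S' S'in.
have [[atS' [P PS' Pz] _] _ _ _ _] := cl'.
have [aP PE] := atS' P PS'.
(* [W] lies in the cores treated before, each of which meets the core of [S'], and so [P], in at
   most [zeta * D] vertices; in total this is at most the width of [P], while each side has three
   times as many vertices. *)
have nP : ~~ nearly_inside P W.
  have hPW : (#|averts P :&: W| <= width P)%N.
    rewrite -(ler_nat R); have [_ hw _ _] := aP; apply: le_trans hw.
    apply: le_trans (_ : Lc%:R * zeta * D <= _); last by rewrite ler_wpM2r ?(ltW D_gt0).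
    apply: le_trans (_ : (size l)%:R * (zeta * D) <= _); last first.
      by rewrite -mulrA ler_wpM2r ?mulr_ge0 ?ler_nat ?(ltW zeta_gt0) ?(ltW D_gt0) // ltnW.
    apply: le_trans (_ : #|averts P :&: \bigcup_(X <- l) z X|%:R <= _).
      by rewrite ler_nat subset_leq_card // setIS.
    have hl X : X \in l -> #|averts P :&: z X|%:R <= zeta * D.
      move=> Xl; apply: le_trans (hzz S' X S'in _ _).
      + by rewrite ler_nat subset_leq_card // setSI.
      + by rewrite inE Xl orbT.
      + by apply: contraNneq S'l => ->.
    elim: (l) hl => [|X l' IHl'] hl; first by rewrite big_nil setI0 cards0 mul0r.
    rewrite big_cons setIUr -natr1 mulrDl mul1r addrC.
    apply: le_trans (_ : #|averts P :&: z X|%:R +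
      #|averts P :&: \bigcup_(Y <- l') z Y|%:R <= _).
      by rewrite -natrD ler_nat leq_card_setU.
    apply: lerD; first by rewrite hl // inE eqxx.
    by apply: IHl' => Y Yl; rewrite hl // inE Yl orbT.
  have h3 : (3 * width P <= #|lside P|)%N.
    by apply: leq_trans (width_le_lside aP); rewrite leq_mul2r L_ge3 orbT.
  have [[_ [cXY _] _ _ _] _ _ _] := aP.
  have main (X : {set T}) : X \subset averts P -> #|X| = #|lside P| ->
      (width P <= #|X :\: W|)%N.
    move=> sX cX; rewrite -(leq_add2l #|X :&: W|) cardsID cX; apply: leq_trans h3.
    apply: (@leq_trans (width P + width P)); last by rewrite addnn -mul2n leq_mul2r orbT.
    by rewrite leq_add2r (leq_trans _ hPW) // subset_leq_card // setSI.
  rewrite /nearly_inside negb_or -!leqNgt !main ?subsetUl ?subsetUr //.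
have [Fr [Vr [FrP VrP dWV hVr kFr]]] := extraction aP nP.
have [U sU [hU hU2]] := overlap_witness g0 g1 (hov S' S'in).
move: sU; rewrite subsetI => /andP[UZ UZ'].
have b0 : 0 <= c0 * level_factor ^+ Lc * merge_factor gamma ^+ size l.
  by rewrite !mulr_ge0 ?exprn_ge0 // ltW.
have b1 : merge_factor gamma ^+ size l <= 1 by rewrite exprn_ile1 // ltW.
have bb : c0 * level_factor ^+ Lc * merge_factor gamma ^+ size l <= c0 * level_factor ^+ Lc.
  by rewrite ler_piMr // mulr_ge0 ?exprn_ge0 // ltW.
have b2 : c0 * level_factor ^+ Lc <= 1.
  by rewrite mulr_ile1 ?exprn_ge0 ?exprn_ile1 // ltW.
have hV' : #|V :|: z S' :|: U|%:R <= (size l).+2%:R * ((J + 2) * 3 ^+ Lc + 2) * D.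
  apply: le_trans (_ : #|V|%:R + #|z S'|%:R + #|U|%:R <= _).
    rewrite -!natrD ler_nat (leq_trans (leq_card_setU _ _)) // leq_add2r.
    exact: leq_card_setU.
  have hS' := cluster_size cl' (ltnW iL').
  rewrite [leRHS](_ : _ = (size l).+1%:R * ((J + 2) * 3 ^+ Lc + 2) * D +
    (J + 2) * 3 ^+ Lc * D + 2 * D); last by rewrite -[(size l).+2%:R]natr1; ring.
  by rewrite !lerD.
exists (F :|: sedges S'), (V :|: z S' :|: U), (K :|: Fr), (W :|: Vr); split.
- rewrite /= exprSr mulrA; apply: cut_dense_on_merge => //.
  + exact: le_trans bb b2.
  + exact: cut_dense_onW bb (subxx _) (cut_dense_on_level cl' (ltnW iL')).
  + apply: le_trans (cluster_core_size cl) _; by rewrite ler_nat subset_leq_card.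
  + exact: cluster_core_size cl'.
  + by apply: subset_trans UZ _; apply: setUSS => //; exact: attachedS.
  + apply: le_trans hV' _; rewrite ler_wpM2r ?(ltW D_gt0) //.
    apply: le_trans M_big; rewrite ler_wpM2r ?ler_nat //.
    by rewrite addr_ge0 // ltW.
- split; first by rewrite subUset FE (cluster_edges cl').
    by rewrite (subset_trans SF) // subsetUl.
  by rewrite (subset_trans ZV) // -setUA subsetUl.
- exact: hV'.
- split; first exact: regular_onU.
  + by rewrite setUSS // (subset_trans FrP) // sedges_sub.
  + rewrite subUset (subset_trans WV) -?setUA ?subsetUl //= (subset_trans VrP) //.
    by rewrite (subset_trans Pz) // setUCA subsetUl.
  + rewrite big_cons subUset (subset_trans Wl) ?subsetUr //.
    by rewrite (subset_trans VrP) // (subset_trans Pz) // subsetUl.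
- rewrite cardsU (disjoint_setI0 dWV) cards0 subn0 natrD /= -natr1 mulrDl mul1r.
  exact: lerD.
Qed.

(** [Lc] such clusters would give a regular graph of order [Lc * q * d], hence at least [C * d], in
    a core that is still [rho]-cut-dense. *)
Lemma few_large_overlaps (gamma : R) S Z i W0 K0 (z : {set atom T} -> {set T})
    (B : {set {set atom T}}) :
  0 < gamma -> gamma <= 1 -> cluster S Z i W0 K0 -> (i < Lc)%N ->
  rho <= c0 * level_factor ^+ Lc * merge_factor gamma ^+ Lc ->
  {in B, forall S', exists i W K, cluster S' (z S') i W K /\ (i < Lc)%N} ->
  {in B, forall S', gamma * D < #|hull S Z :&: hull S' (z S')|%:R} ->
  {in B &, forall S1 S2 : {set atom T}, S1 != S2 -> #|z S1 :&: z S2|%:R <= zeta * D} ->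
  (#|B| < Lc)%N.
Proof.
move=> g0 g1 cl iL hrho hcl hov hzz; rewrite ltnNge; apply/negP => /exists_subset_card.
move=> [B' /subsetP sB cB'].
have sl : size (enum B') = Lc by rewrite -cardE.
have [|||||F [V [K [W [cV [FE _ _] hV [kK KF WV _] hW]]]]] :=
  @overlap_core gamma S Z i W0 K0 z (enum B') g0 g1 cl iL.
- by move=> X; rewrite mem_enum => /sB; exact: hcl.
- by move=> X; rewrite mem_enum => /sB; exact: hov.
- by move=> X Y; rewrite !mem_enum => /sB ? /sB ?; exact: hzz.
- exact: enum_uniq.
- by rewrite sl.
rewrite sl in cV hV hW.
have : #|W|%:R < C * D.
  apply: core_free FE (cut_dense_onW hrho (subxx _) cV) _ KF WV kK.
  by apply: le_trans hV _; rewrite ler_wpM2r // ltW.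
apply/negP; rewrite -leNgt; apply: le_trans hW.
by rewrite mulrA ler_wpM2r // ltW.
Qed.

End Clusters.

(** * Assembling the decomposition *)

Fact subgraph_on_is_graph (T : finType) (F : {set {set T}}) (Z : {set T}) :
  is_graph (Z, [set e in F | (e \subset Z) && (#|e| == 2)]).
Proof.
by apply/forallP => e; apply/implyP; rewrite inE /= => /andP[].
Qed.

Definition subgraph_on (T : finType) F Z : graph T := Graph (@subgraph_on_is_graph T F Z).

Section Graphs.
Variable T : finType.
Implicit Types (G H : graph T) (E F K : {set {set T}}) (Z W : {set T}).

Lemma edge_card G e : e \in edges G -> #|e| = 2.
Proof.
by move=> eG; have /forallP/(_ e)/implyP/(_ eG)/andP[_ /eqP] := valP G.
Qed.

Lemma edge_subset G e : e \in edges G -> e \subset verts G.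
Proof.
by move=> eG; have /forallP/(_ e)/implyP/(_ eG)/andP[] := valP G.
Qed.

Lemma edges_subgraph_on F Z : (forall e, e \in F -> e \subset Z /\ #|e| = 2) ->
  edges (subgraph_on F Z) = F.
Proof.
move=> h; apply/setP => e; rewrite inE; case eF: (e \in F) => //=.
by have [-> ->] := h e eF.
Qed.

Lemma edges_subgraph_onE F Z e :
  e \in edges (subgraph_on F Z) = [&& e \in F, e \subset Z & #|e| == 2].
Proof. by rewrite inE. Qed.

Lemma adj_subgraph_on F Z x y : (forall e, e \in F -> #|e| = 2) ->
  adj (subgraph_on F Z) x y = [&& eadj F x y, x \in Z & y \in Z].
Proof.
move=> F2; rewrite /adj edges_subgraph_onE subUset !sub1set.
by case xy: (_ \in F) => //=; rewrite ?(F2 _ xy) ?andbT /eadj xy.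
Qed.

Lemma cut_dense_subgraph_on (R : realType) (rho : R) F Z :
  (forall e, e \in F -> #|e| = 2) -> cut_dense_on rho F Z -> cut_dense rho (subgraph_on F Z).
Proof.
move=> F2 cZ A B AB dAB; apply: le_trans (cZ A B AB dAB) _.
rewrite ler_nat; apply/subset_leq_card/subsetP => -[x y]; rewrite !inE /=.
case/andP=> /andP[xA yB] xy; rewrite xA yB /= adj_subgraph_on // xy /=.
by move: AB; rewrite /verts /= => <-; rewrite !inE xA yB orbT.
Qed.

Lemma regular_subgraph_on k K W : (forall e, e \in K -> #|e| = 2) -> regular_on k K W ->
  Defs.regular k (subgraph_on K W).
Proof.
move=> K2 [_ kW]; apply/forallP => v; apply/implyP => vW; apply/eqP.
rewrite -(kW v vW); apply: eq_card => u; rewrite !inE adj_subgraph_on //.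
by rewrite [v \in W]vW /verts /=; case: (u \in W); rewrite ?andbF ?andbT.
Qed.

Lemma subgraph_subgraph_on F F' Z Z' : F \subset F' -> Z \subset Z' ->
  subgraph (subgraph_on F Z) (subgraph_on F' Z').
Proof.
move=> /subsetP sF sZ; rewrite /subgraph sZ; apply/subsetP => e.
by rewrite !edges_subgraph_onE => /and3P[/sF-> /subset_trans->].
Qed.

Lemma cut_dense_on_covered (R : realType) (rho : R) F Z : 0 < rho -> (1 < #|Z|)%N ->
  cut_dense_on rho F Z -> forall x, x \in Z -> exists2 y, y \in Z & eadj F x y.
Proof.
move=> rho0 Z2 cZ x xZ.
have := cZ [set x] (Z :\ x); rewrite setD1K // => /(_ erefl).
rewrite disjoints1 !inE eqxx /= => /(_ isT) h.
have Zx : (0 < #|Z :\ x|)%N by move: Z2; rewrite (cardsD1 x) xZ.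
have : 0 < (npairs (eadj F) [set x] (Z :\ x))%:R :> R.
  by apply: lt_le_trans h; rewrite cards1 mulr1 mulr_gt0 // ltr0n.
rewrite ltr0n card_gt0 => /set0Pn[[u v]]; rewrite !inE /=.
by case/andP=> /andP[/eqP-> /andP[_ vZ]]; exists v.
Qed.

(** [cut_dense_on] does not place [Z] in any graph; but cutting off a single vertex shows that each
    vertex of [Z] lies on an edge. *)
Lemma cut_dense_on_sub_verts (R : realType) (rho : R) F Z W : 0 < rho -> (1 < #|Z|)%N ->
  cut_dense_on rho F Z -> (forall e, e \in F -> e \subset W) -> Z \subset W.
Proof.
move=> rho0 Z2 cZ FW; apply/subsetP => x xZ.
have [y _ /FW] := cut_dense_on_covered rho0 Z2 cZ xZ.
by rewrite subUset !sub1set => /andP[].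
Qed.

(** A large core left over would be a candidate for the maximal family. It has at least two vertices
    because [2 <= C * d], hence an edge, while maximality leaves only candidates without edges. *)
Lemma large_cores_removed (R : realType) (C q M rho : R) (d : nat) G :
  0 < rho -> 2 <= C * d%:R ->
  exists HH : {set graph T},
  [/\ forall H, H \in HH -> subgraph H G /\
      [/\ cut_dense rho H,
          exists K : graph T,
            [/\ subgraph K H, Defs.regular (Num.truncn (q * d%:R)) K
              & C * d%:R <= #|verts K|%:R]
        & #|verts H|%:R <= M * d%:R],
    {in HH &, forall H H', H != H' -> edge_disjoint H H'}
  & forall F Z K W, F \subset edges G :\: \bigcup_(H in HH) edges H ->
      cut_dense_on rho F Z -> #|Z|%:R <= M * d%:R -> K \subset F -> W \subset Z ->
      regular_on (Num.truncn (q * d%:R)) K W -> #|W|%:R < C * d%:R].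
Proof.
move=> rho0 Cd2.
pose p H := subgraph H G /\
      [/\ cut_dense rho H,
          exists K : graph T,
            [/\ subgraph K H, Defs.regular (Num.truncn (q * d%:R)) K
              & C * d%:R <= #|verts K|%:R]
        & #|verts H|%:R <= M * d%:R].
have [HH [pHH dHH mHH]] := maximal_disjoint_family (@edges T) p (edges G).
exists HH; split=> //; first by move=> H /pHH[].
move=> F Z K W FE cZ hZ KF WZ kK; rewrite ltNge; apply/negP => hW.
have FG : F \subset edges G by rewrite (subset_trans FE) // subsetDl.
have F2 e : e \in F -> #|e| = 2 by move=> /(subsetP FG)/edge_card.
have Z2 : (1 < #|Z|)%N.
  by rewrite (leq_trans _ (subset_leq_card WZ)) // -(ler_nat R) (le_trans Cd2).
have ZG : Z \subset verts G.
  by apply: cut_dense_on_sub_verts rho0 Z2 cZ _ => e /(subsetP FG)/edge_subset.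
have pH : p (subgraph_on F Z).
  split.
    rewrite /subgraph ZG; apply/subsetP => e; rewrite edges_subgraph_onE.
    by case/and3P=> /(subsetP FG).
  split; [exact: cut_dense_subgraph_on| |by []].
  exists (subgraph_on K W); split; [exact: subgraph_subgraph_on| |by []].
  by apply: regular_subgraph_on kK => e /(subsetP KF)/F2.
have [Z0|[x xZ]] := set_0Vmem Z; first by rewrite Z0 cards0 in Z2.
have [y yZ xy] := cut_dense_on_covered rho0 Z2 cZ xZ.
have : [set x; y] \in edges (subgraph_on F Z).
  by rewrite edges_subgraph_onE [_ \in F]xy subUset !sub1set xZ yZ (F2 _ xy).
rewrite mHH ?inE //; apply: subset_trans FE.
by apply/subsetP => e; rewrite edges_subgraph_onE => /andP[].
Qed.

(** Each edge lies in one of the disjoint sets [D i], so a component with an edge stays inside a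
    single [D i], and [w i] meets all its edges. A component without edges has the empty cover. *)
Lemma component_cover G (I : finType) (A : {set I}) (D w : I -> {set T}) :
  {in A &, forall i j, i != j -> [disjoint D i & D j]} ->
  (forall e, e \in edges G ->
    exists i, [/\ i \in A, e \subset D i & e :&: w i != set0]) ->
  forall K : graph T, K \in components G ->
    exists2 S : {set T}, vertex_cover K S &
      S = set0 \/ exists2 i, i \in A & S \subset w i.
Proof.
move=> dD hG K /imsetP[x xG KE].
have [K0|[e eK]] := set_0Vmem (edges K).
  exists set0; last by left.
  by rewrite /vertex_cover sub0set; apply/forallP => e; rewrite K0 inE.
have eKE f : f \in edges K = (f \in edges G) && (f \subset [set y | connect (adj G) x y]).
  by rewrite KE inE.
have /andP[eG eC] : (e \in edges G) && (e \subset [set y | connect (adj G) x y]).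
  by rewrite -eKE.
have [i [iA eD ew]] := hG e eG.
exists (w i :&: verts K); last by right; exists i; rewrite ?subsetIl.
rewrite /vertex_cover subsetIr /=; apply/forallP => f; apply/implyP => fK.
have /andP[fG fC] : (f \in edges G) && (f \subset [set y | connect (adj G) x y]).
  by rewrite -eKE.
have cl : closed (adj G) (mem (D i)).
  move=> y z /hG[j [jA]]; rewrite subUset !sub1set => /andP[yj zj] _.
  have [ij|ij] := eqVneq i j; first by rewrite ij yj zj.
  by rewrite (disjointFl (dD i j iA jA ij) yj) (disjointFl (dD i j iA jA ij) zj).
have [u ue] : exists u, u \in e.
  by apply/set0Pn; rewrite -card_gt0 (edge_card eG).
have xD : x \in D i.
  have := subsetP eC u ue; rewrite inE => /(closed_connect cl).
  by rewrite (subsetP eD u ue).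
have CD : [set y | connect (adj G) x y] \subset D i.
  by apply/subsetP => y; rewrite inE => /(closed_connect cl) <-.
have [j [jA fD fw]] := hG f fG.
have ij : i = j.
  apply/eqP; apply: contraT => ij.
  have [v vf] : exists v, v \in f.
    by apply/set0Pn; rewrite -card_gt0 (edge_card fG).
  have := disjointFr (dD i j iA jA ij) (subsetP CD v (subsetP fC v vf)).
  by rewrite (subsetP fD v vf).
have [v] := set0Pn _ fw; rewrite -ij inE => /andP[vf vw].
apply/set0Pn; exists v; rewrite !inE vf vw /=.
by apply: (subsetP (edge_subset fK)).
Qed.

End Graphs.

(** * Distributing the edges of the clusters among [G0], [G1] and [G4] *)

Section Assembly.
Variables (R : realType) (T : finType) (J alpha theta lambda epsilon : R) (L d : nat).
Variables (SS : {set {set atom T}}) (z w : {set atom T} -> {set T}).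
Implicit Types (P : atom T) (S : {set atom T}).

Hypothesis d_gt0 : (0 < d)%N.
Hypothesis L_ge3 : (3 <= L)%N.
Hypothesis alpha_gt0 : 0 < alpha.
Hypothesis lambda_le : lambda <= alpha.
Hypothesis L_eps : 4 <= L%:R * epsilon.
Hypothesis atomSS : forall S P, S \in SS -> P \in S -> is_atom J alpha theta L d P.
Hypothesis disSS : {in SS &, forall S S' : {set atom T}, S != S' -> [disjoint S & S']}.
Hypothesis disA : {in \bigcup_(S in SS) S &, forall P P', P != P' ->
  [disjoint aedges P & aedges P']}.
Hypothesis wz : forall S, S \in SS -> w S \subset z S.
Hypothesis satSS : forall S, S \in SS -> saturated S (w S).

Definition piece_verts S := hull alpha d S (z S).

Definition piece_edges S := [set e in sedges S | e \subset piece_verts S].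

Lemma sedges_atom S S' P e : S \in SS -> S' \in SS -> P \in S ->
  e \in aedges P -> e \in sedges S' -> S = S'.
Proof.
move=> hS hS' PS eP /bigcupP[P' P'S' eP'].
have PP' : P = P'.
  apply/eqP; apply: contraT => PP'.
  have PU : P \in \bigcup_(S in SS) S by apply/bigcupP; exists S.
  have P'U : P' \in \bigcup_(S in SS) S by apply/bigcupP; exists S'.
  by have := disjointFr (disA PU P'U PP') eP; rewrite eP'.
apply/eqP; apply: contraT => SS'; have := disjointFr (disSS hS hS' SS') PS.
by rewrite PP' P'S'.
Qed.

Lemma sedges_disjoint S S' : S \in SS -> S' \in SS -> S != S' ->
  [disjoint sedges S & sedges S'].
Proof.
move=> hS hS' SS'; apply/pred0P => e /=; apply/negP => /andP[/bigcupP[P PS eP] eS'].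
by move/eqP: SS'; apply; exact: sedges_atom eP eS'.
Qed.

(** By saturation the atom is nearly inside [w S]. Apart from the edges at fewer than [width P]
    vertices, its edges meet [w S], and an end outside [w S] has [width P >= alpha * d] neighbours
    there, so it lies in the hull. *)
Lemma atom_lost S P : S \in SS -> P \in S ->
  exists2 X : {set T}, (#|X| < width P)%N
    & forall e, e \in aedges P -> [disjoint e & X] ->
      e :&: w S != set0 /\ e \in piece_edges S.
Proof.
move=> hS PS; have aP := atomSS hS PS.
have [X [cX hX]] := nearly_inside_lost aP L_ge3 (satSS hS PS).
exists X => // e eP eX; have [ew hv] := hX e eP eX; split=> //.
have PE : aedges P \subset sedges S by exact: bigcup_sup.
rewrite inE (subsetP PE _ eP) /=; apply/subsetP => v ve; rewrite inE.
have [vw|vw] := boolP (v \in w S); first by rewrite (subsetP (wz hS) v vw).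
apply/orP; right; rewrite inE; have [_ hw _ _] := aP; apply: le_trans hw _.
rewrite ler_nat (leq_trans (hv v ve vw)) // (leq_trans (degreeS _ _ (wz hS))) //.
exact/sub_degree/eadjS.
Qed.

Let eps0 : 0 <= epsilon.
Proof.
rewrite leNgt; apply/negP => neg; have : L%:R * epsilon <= 0.
  by rewrite mulr_ge0_le0 // ltW.
by move: L_eps; lra.
Qed.

Lemma lost_small P (X Y : {set T}) (F : {set {set T}}) :
  is_atom J alpha theta L d P -> (#|X| < width P)%N -> (#|Y| <= width P)%N ->
  (forall e, e \in aedges P -> e \in F -> ~~ [disjoint e & X] || ~~ [disjoint e & Y]) ->
  #|aedges P :&: F|%:R <= epsilon * #|aedges P|%:R.
Proof.
move=> aP cX cY hF.
have h1 : (#|aedges P :&: F| <= 4 * (#|lside P| * width P))%N.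
  apply: (@leq_trans #|[set e in aedges P | ~~ [disjoint e & X :|: Y]]|).
    apply/subset_leq_card/subsetP => e; rewrite !inE => /andP[eP eF].
    rewrite eP /=; case/orP: (hF e eP eF) => /pred0Pn[v /andP[/= ve vX]];
    by apply/pred0Pn; exists v; rewrite /= ve inE vX ?orbT.
  apply: leq_trans (aedges_touch _ aP) _.
  rewrite (_ : 4 = 2 * 2)%N // -!mulnA leq_mul2l /= mulnCA leq_mul2l; apply/orP; right.
  by rewrite mul2n -addnn (leq_trans (leq_card_setU _ _)) // leq_add // ltnW.
have h2 := aedges_size aP.
move: h1 h2; rewrite -!(ler_nat R) !natrM => h1 h2; apply: le_trans h1 _.
apply: le_trans (ler_wpM2l eps0 h2).
rewrite [leRHS](_ : _ = L%:R * epsilon * (#|lside P|%:R * (width P)%:R)); last by ring.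
by rewrite ler_wpM2r // mulr_ge0.
Qed.

(** The loss is estimated atom by atom: an atom loses only edges at the exceptional vertices of
    [atom_lost] and, in a removed cluster, at the shared vertices. *)
Lemma split_pieces : exists (B : {set {set atom T}}) (D : {set atom T} -> {set T})
    (E1 : {set {set T}}),
  let E4 := \bigcup_(S in B) piece_edges S in
  let EA := \bigcup_(S in SS) sedges S in
  [/\ B \subset SS,
    forall S, S \in B -> lambda * d%:R <= #|shared piece_verts B S|%:R,
    {in SS :\: B &, forall S S', S != S' -> [disjoint D S & D S']},
    forall e, e \in E1 -> exists S, [/\ S \in SS :\: B, e \subset D S & e :&: w S != set0]
  & [/\ E1 \subset EA, E4 \subset EA, [disjoint E1 & E4]
    & #|EA :\: (E1 :|: E4)|%:R <= epsilon * #|EA|%:R]].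
Proof.
have [B [D [sB hB hD dD]]] :=
  peel_lightly_shared piece_verts (fun n => n%:R < lambda * d%:R) SS.
pose F1 S := [set e in sedges S | (e \subset D S) && (e :&: w S != set0)].
pose E1 := \bigcup_(S in SS :\: B) F1 S.
exists B, D, E1; move=> E4 EA.
have F1P S e : e \in F1 S -> e \in sedges S by rewrite inE => /andP[].
have E4A : E4 \subset EA.
  apply/bigcupsP => S SB; apply/subsetP => e; rewrite inE => /andP[eS _].
  by apply/bigcupP; exists S => //; exact: subsetP sB S SB.
have E1A : E1 \subset EA.
  apply/bigcupsP => S; rewrite inE => /andP[_ hS]; apply/subsetP => e /F1P eS.
  by apply/bigcupP; exists S.
split=> //.
- by move=> S /hB; rewrite -leNgt.
- move=> e /bigcupP[S hS]; rewrite inE => /and3P[_ eD ew]; by exists S.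
split=> //.
  apply/pred0P => e /=; apply/negP => /andP[/bigcupP[S]].
  rewrite inE => /andP[SB hS] /F1P eS /bigcupP[S' S'B]; rewrite inE => /andP[eS' _].
  have hS' := subsetP sB S' S'B.
  have SS' : S != S' by apply: contraNneq SB => ->.
  by have := disjointFr (sedges_disjoint hS hS' SS') eS; rewrite eS'.
set A := \bigcup_(S in SS) S; set E0 := EA :\: _.
have EAE : EA = \bigcup_(P in A) aedges P.
  apply/setP => e; apply/bigcupP/bigcupP => [[S hS /bigcupP[P PS eP]]|[P /bigcupP[S hS PS] eP]].
    by exists P => //; apply/bigcupP; exists S.
  by exists S => //; apply/bigcupP; exists P.
have lost P : P \in A -> #|aedges P :&: E0|%:R <= epsilon * #|aedges P|%:R.
  move=> /bigcupP[S hS PS]; have aP := atomSS hS PS.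
  have PE : aedges P \subset sedges S by exact: bigcup_sup.
  have [X cX hX] := atom_lost hS PS.
  have [SB|SB] := boolP (S \in B).
    have cY : (#|set0 : {set T}| <= width P)%N by rewrite cards0.
    apply: (lost_small aP cX cY) => e eP.
    rewrite inE => /andP[+ _]; rewrite inE negb_or => /andP[_ e4].
    apply/orP; left; apply: contra e4 => eX; have [_ ep] := hX e eP eX.
    by apply/bigcupP; exists S.
  have hSB : S \in SS :\: B by rewrite inE SB.
  have [DV small] := hD S hSB.
  (* The removed cluster was lightly shared: fewer than [lambda * d <= alpha * d] vertices are cut
     off. *)
  have cY : (#|piece_verts S :\: D S| <= width P)%N.
    rewrite -(ler_nat R); have [_ hw _ _] := aP; apply: le_trans hw.
    apply: le_trans (ltW small) _; by rewrite ler_wpM2r.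
  apply: (lost_small aP cX cY) => e eP.
  rewrite inE => /andP[+ _]; rewrite inE negb_or => /andP[e1 _].
  rewrite -negb_and; apply: contra e1 => /andP[eX eY].
  have [ew] := hX e eP eX; rewrite inE => /andP[eS eV].
  apply/bigcupP; exists S => //; rewrite inE eS ew andbT /=.
  apply/subsetP => v ve; have := disjointFr eY ve.
  by rewrite inE (subsetP eV v ve) andbT => /negbFE.
have cE0 : (#|E0| <= \sum_(P in A) #|aedges P :&: E0|)%N.
  apply: (@leq_trans #|\bigcup_(P in A) (aedges P :&: E0)|).
    by rewrite -big_distrl /= -EAE subset_leq_card // subsetI subxx subsetDl.
  apply: (big_ind2 (fun (X : {set {set T}}) a => (#|X| <= a)%N)) => //.
    by rewrite cards0.
  by move=> X a Y b aX bY; exact: leq_trans (leq_card_setU _ _) (leq_add aX bY).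
apply: le_trans (_ : (\sum_(P in A) #|aedges P :&: E0|)%:R <= _); first by rewrite ler_nat.
apply: le_trans (_ : epsilon * (\sum_(P in A) #|aedges P|)%:R <= _).
  by rewrite !natr_sum mulr_sumr ler_sum.
by rewrite ler_wpM2l // ler_nat EAE sum_card_disjoint.
Qed.

Lemma pieces_well_connected (beta zeta gamma : R) (G4 : graph T)
    (B : {set {set atom T}}) :
  B \subset SS -> beta <= alpha ->
  verts G4 = \bigcup_(S in B) piece_verts S ->
  edges G4 = \bigcup_(S in B) piece_edges S ->
  (forall S e, S \in SS -> e \in sedges S -> #|e| = 2) ->
  (forall S, S \in SS -> cut_dense_on beta (sedges S) (z S)) ->
  (forall S, S \in SS -> alpha * d%:R <= #|z S|%:R) ->
  (forall S, S \in SS -> exists2 P, P \in S & averts P \subset z S) ->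
  {in SS &, forall S S' : {set atom T}, S != S' ->
      #|piece_verts S :&: piece_verts S'|%:R <= zeta * d%:R} ->
  (forall S, S \in B -> lambda * d%:R <= #|shared piece_verts B S|%:R) ->
  (forall S (B' : {set {set atom T}}), S \in B -> B' \subset B ->
    (forall S', S' \in B' -> gamma * d%:R < #|piece_verts S :&: piece_verts S'|%:R) ->
    (#|B'|)%:R <= 1 / lambda) ->
  well_connected_pieces lambda zeta beta gamma d G4.
Proof.
move=> /subsetP sB beta_le vG4 eG4 E2 hcut hz hcore hov hsh hfew.
pose H S := subgraph_on (sedges S) (piece_verts S).
have HE S : S \in SS -> edges (H S) = piece_edges S.
  move=> hS; apply/setP => e; rewrite !inE; case eS: (e \in _) => //=.
  by rewrite (E2 S) // eqxx andbT.
(* The pieces form a set of graphs, so distinct clusters must give distinct graphs. They do, being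
   edge-disjoint and not edgeless: each contains a whole atom. *)
have H0 S : S \in SS -> exists e, e \in edges (H S).
  move=> hS; have [P PS Pz] := hcore S hS; have aP := atomSS hS PS.
  have [e eP] : exists e, e \in aedges P.
    apply/set0Pn; rewrite -card_gt0; apply: leq_trans (aedges_size aP).
    have [[_ [_ X0] _ _ _] hw _ _] := aP.
    rewrite !muln_gt0 X0 (leq_trans _ L_ge3) //= -(ltr0n R) (lt_le_trans _ hw) //.
    by rewrite mulr_gt0 // ltr0n.
  exists e; rewrite HE // inE (subset_trans (aedge_sub aP eP)) ?andbT.
    by apply/bigcupP; exists P.
  by rewrite (subset_trans Pz) // subsetUl.
have Hdis S S' : S \in SS -> S' \in SS -> S != S' -> edge_disjoint (H S) (H S').
  move=> hS hS' SS'; rewrite /edge_disjoint !HE //.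
  have sub X : piece_edges X \subset sedges X by apply/subsetP => e; rewrite inE => /andP[].
  by rewrite (disjointWl (sub S)) // (disjointWr (sub S')) // sedges_disjoint.
have Hinj S S' : S \in SS -> S' \in SS -> S != S' -> H S != H S'.
  move=> hS hS' SS'; apply/eqP => HH; have := Hdis S S' hS hS' SS'.
  have [e eH] := H0 S' hS'; rewrite HH /edge_disjoint => /disjointFr/(_ eH).
  by rewrite eH.
exists (H @: B).
  split.
  - rewrite vG4; apply/setP => x.
    apply/bigcupP/bigcupP => [[S hS xS]|[_ /imsetP[S hS ->] xS]].
      by exists (H S); rewrite ?imset_f.
    by exists S.
  - rewrite eG4; apply/setP => x.
    apply/bigcupP/bigcupP => [[S hS xS]|[_ /imsetP[S hS ->] xS]].
      by exists (H S); rewrite ?imset_f // HE // sB.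
    by exists S; rewrite // -HE // sB.
  - move=> _ _ /imsetP[S hS ->] /imsetP[S' hS' ->] HH; apply: Hdis; try exact: sB.
    by apply: contraNneq HH => ->.
split.
- move=> _ /imsetP[S /sB hS ->]; exists (subgraph_on (sedges S) (z S)); split.
  + by apply: subgraph_subgraph_on => //; exact: subsetUl.
  + by apply: le_trans (hz S hS); rewrite ler_wpM2r.
  + by apply: cut_dense_subgraph_on (hcut S hS) => e; exact: E2.
  + move=> v; rewrite inE => /andP[vz vH].
    have va : v \in attached alpha d (sedges S) (z S).
      by move: vH; rewrite [in _ -> _]inE (negPf vz).
    apply: le_trans (_ : alpha * d%:R <= _); first by rewrite ler_wpM2r.
    move: va; rewrite inE => /le_trans; apply; rewrite ler_nat.
    apply/subset_leq_card/subsetP => y; rewrite !inE => /andP[yz vy].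
    have yH : y \in piece_verts S by rewrite inE yz.
    rewrite [y \in verts (subgraph_on _ (z S))]yz andbT adj_subgraph_on;
      last by move=> e; exact: E2.
    by rewrite vy [v \in _]vH yH.
- move=> _ _ /imsetP[S hS ->] /imsetP[S' hS' ->] HH; apply: hov; try exact: sB.
  by apply: contraNneq HH => ->.
- move=> _ /imsetP[S hS ->]; apply: le_trans (hsh S hS) _.
  rewrite ler_nat; apply/subset_leq_card/subsetP => v /setIdP[vS].
  case/existsP=> S' /and3P[hS' SS' vS']; apply/setIdP; split; first exact: vS.
  apply/existsP; exists (H S'); rewrite imset_f // Hinj ?sB //=.
- move=> _ /imsetP[S hS ->].
  pose B' := [set S' in B | (gamma * d%:R < #|piece_verts S :&: piece_verts S'|%:R)
    && (H S' != H S)].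
  apply: le_trans (_ : (#|B'|)%:R <= _).
    rewrite ler_nat; apply: leq_trans (leq_imset_card H _).
    apply/subset_leq_card/subsetP => H'; rewrite inE => /and3P[/imsetP[S' hS' ->] ne big].
    by apply/imsetP; exists S'; rewrite // inE hS' ne big.
  by apply: hfew hS _ _ => [|S']; [apply/subsetP => S'|]; rewrite inE => /and3P[].
Qed.

End Assembly.

(** Both sides keep [width P] vertices outside [W], so quasirandomness leaves a dense graph there,
    from which a regular subgraph avoiding [W] can be extracted afresh. *)
Lemma atom_dense_outside (R : realType) (T : finType) (J alpha theta : R) L d
    (P : atom T) W :
  is_atom J alpha theta L d P -> ~~ nearly_inside P W ->
  theta * d%:R ^+ 2 <= (npairs (eadj (aedges P)) (averts P :\: W) (averts P :\: W))%:R.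
Proof.
move=> [[_ _ _ _ dense] _ _ _]; rewrite /nearly_inside negb_or -!leqNgt.
case/andP=> hl hr; apply: le_trans (dense _ _ (subsetDl _ W) (subsetDl _ W) hl hr) _.
by rewrite ler_nat npairsS // setSD // ?subsetUl ?subsetUr.
Qed.

Theorem theorem2p1 (R : realType) (C J epsilon delta : R) :
  0 < C -> 0 < J -> 0 < epsilon -> 0 < delta ->
  exists lambda q M : R, [/\ 0 < lambda, 0 < q, 0 < M &
  forall zeta : R, 0 < zeta ->
  exists2 beta : R, 0 < beta &
  forall gamma : R, 0 < gamma ->
  exists2 rho : R, 0 < rho &
  exists d0 : nat, forall d : nat, (d0 <= d)%N ->
  forall (T : finType) (G : graph T),
  exists G0 G1 G2 G3 G4 : graph T,
    edge_decomposition G [:: G0; G1; G2; G3; G4] /\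
    [/\ #|edges G0|%:R <= epsilon * #|edges G|%:R,
        small_vertex_cover C d G1,
        large_regular_cores C q M rho d G2,
        nowhere_dense J delta d G3
      & well_connected_pieces lambda zeta beta gamma d G4]].
Proof.
move=> C0 J0 eps0 delta0.
pose L := maxn 3 (Num.truncn (4 / epsilon)).+1.
have L3 : (3 <= L)%N by exact: leq_maxl.
have Leps : 4 <= L%:R * epsilon.
  rewrite -ler_pdivrMr // ltW // (lt_le_trans (truncnS_gt _)) // ler_nat.
  exact: leq_maxr.
have [alpha [theta [alpha0 theta0 [dA hA]]]] :=
  exists_atom J0 delta0 (leq_trans (isT : (0 < 3)%N) L3).
have [q q0 [dB hB]] := exists_regular_on J0 theta0.
(* The number of levels: [Lc] disjoint regular graphs of order [q * d] add up to [C * d]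
   vertices. *)
pose Lc := (Num.truncn (C / q)).+1.
have Lc_big : C <= Lc%:R * q by rewrite -ler_pdivrMr // ltW // truncnS_gt.
pose m := (J + 2) * 3 ^+ Lc + 2 : R.
have m0 : 0 < m by rewrite addr_gt0 // mulr_gt0 ?exprn_gt0 // addr_gt0.
pose M := Lc.+1%:R * m + alpha.
have alphaM : alpha <= M by rewrite lerDr mulr_ge0 // ltW.
have M_big : Lc.+1%:R * m <= M by rewrite lerDl ltW.
have M0 : 0 < M by exact: lt_le_trans alphaM.
(* [alpha] keeps the vertices cut off a removed cluster within the width of an atom; the other bound
   allows [Lc] heavy overlaps. *)
pose lambda := Num.min alpha (1 / Lc.+1%:R).
have lambda0 : 0 < lambda by rewrite lt_min alpha0 divr_gt0.
have lambda_alpha : lambda <= alpha by rewrite ge_min lexx.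
have Lc_lambda : Lc%:R <= 1 / lambda.
  rewrite ler_pdivlMr // (le_trans _ (_ : Lc.+1%:R * (1 / Lc.+1%:R) <= 1)) //.
    by rewrite ler_pM ?ler_nat ?(ltW lambda0) // ge_min lexx orbT.
  by rewrite mul1r divff // pnatr_eq0.
exists lambda, q, M; split=> // zeta0 zeta00.
(* Clusters are built with a possibly smaller overlap bound, which implies the one for [zeta0];
   [gamma0] is treated likewise below. *)
pose zeta := Num.min zeta0 (Num.min 1 (alpha / Lc%:R)).
have Lc0 : 0 < Lc%:R :> R by [].
have zeta_gt0 : 0 < zeta by rewrite !lt_min zeta00 ltr01 divr_gt0.
have zeta_le1 : zeta <= 1 by rewrite !ge_min lexx orbT.
have Lc_zeta : Lc%:R * zeta <= alpha.
  by rewrite mulrC -ler_pdivlMr // !ge_min lexx !orbT.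
pose c0 := Num.min 1 (Num.min (theta / J ^+ 2) (alpha / J)).
have c00 : 0 < c0 by rewrite !lt_min ltr01 !divr_gt0 ?exprn_gt0.
have c01 : c0 <= 1 by rewrite ge_min lexx.
have c0t : c0 <= theta / J ^+ 2 by rewrite !ge_min lexx orbT.
have c0a : c0 <= alpha / J by rewrite !ge_min lexx !orbT.
have lf0 := level_factor_gt0 alpha0 alphaM zeta_gt0.
pose c1 := c0 * level_factor alpha M zeta ^+ Lc.
have c10 : 0 < c1 by rewrite mulr_gt0 ?exprn_gt0.
(* [c1] is the cut-density of a core at any level reached, [alpha] governs its order and the
   attached vertices. *)
pose beta := Num.min c1 alpha.
have beta0 : 0 < beta by rewrite lt_min c10.
exists beta => // gamma0 gamma00.
pose gamma := Num.min gamma0 1.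
have gamma_gt0 : 0 < gamma by rewrite lt_min gamma00 ltr01.
have gamma_le1 : gamma <= 1 by rewrite ge_min lexx orbT.
have mf0 := merge_factor_gt0 alpha0 alphaM gamma_gt0.
have mf1 := merge_factor_le1 J0 alpha0 alphaM M_big gamma_gt0 gamma_le1.
(* The cut-density left after a core is joined to [Lc] others along overlaps of order [gamma * d];
   being at most [c1], it also serves for single cores. *)
pose rho := c1 * merge_factor alpha M gamma ^+ Lc.
have rho0 : 0 < rho by rewrite mulr_gt0 ?exprn_gt0.
have rho_small : rho <= c1 by rewrite ler_piMr ?(ltW c10) // exprn_ile1 // ltW.
exists rho => //.
exists (maxn (maxn dA dB) (maxn 1 (maxn (Num.truncn (2 / C)).+1 (Num.truncn (2 / alpha)).+1))).
move=> d; rewrite !geq_max => /andP[/andP[ddA ddB] /andP[d_gt0 /andP[dC dalpha]]] T G.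
have Cd2 : 2 <= C * d%:R.
  by rewrite mulrC -ler_pdivrMr // ltW // (lt_le_trans (truncnS_gt _)) // ler_nat.
have ad2 : 2 <= alpha * d%:R.
  by rewrite mulrC -ler_pdivrMr // ltW // (lt_le_trans (truncnS_gt _)) // ler_nat.
have D0 : 0 < d%:R :> R by rewrite ltr0n.
have [HH [pHH dHH core_free]] := @large_cores_removed T R C q M rho d G rho0 Cd2.
set E2 := \bigcup_(H in HH) edges H in core_free.
pose E' := edges G :\: E2.
have E'G : E' \subset edges G := subsetDl _ _.
have E'2 e : e \in E' -> #|e| = 2 by move=> /(subsetP E'G)/edge_card.
have [A [hAt dAt mAt]] := maximal_disjoint_family (@aedges T)
  (is_atom J alpha theta L d) E'.
have extraction P W : is_atom J alpha theta L d P -> ~~ nearly_inside P W ->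
    exists (F : {set {set T}}) (V : {set T}), [/\ F \subset aedges P,
      V \subset averts P, [disjoint W & V], q * d%:R <= #|V|%:R
      & regular_on (Num.truncn (q * d%:R)) F V].
  move=> aP nP; have [_ _ hJ _] := aP.
  have cS : #|averts P :\: W|%:R <= J * d%:R.
    by apply: le_trans hJ; rewrite ler_nat subset_leq_card // subsetDl.
  have [F [V [FP VP hV kF]]] := hB d ddB T (aedges P) _ (fun e => aedge_card aP (e:=e)) cS
    (atom_dense_outside aP nP).
  exists F, V; split=> //; first exact: subset_trans VP (subsetDl _ _).
  rewrite disjoint_sym (disjointWl VP) // disjoints_subset.
  by apply/subsetP => x; rewrite !inE => /andP[].
have atA P : P \in A -> is_atom J alpha theta L d P /\ aedges P \subset E'.
  by move=> /hAt[].
have [SS [z [w [cSS dSS clSS ovSS]]]] := cluster_family d_gt0 L3 J0 alpha0 alphaM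
  c00 c01 c0t c0a zeta_gt0 zeta_le1 M_big Lc_big rho_small extraction core_free atA.
have atomSS S P : S \in SS -> P \in S -> is_atom J alpha theta L d P.
  by move=> hS PS; apply: (atA P _).1; rewrite -cSS; apply/bigcupP; exists S.
have wz S : S \in SS -> w S \subset z S.
  by move=> /clSS[i [K [[_ _ _ [_ _ ?] _] _ _]]].
have sat S : S \in SS -> saturated S (w S) by move=> /clSS[i [K []]].
have disA : {in \bigcup_(S in SS) S &, forall P P', P != P' ->
    [disjoint aedges P & aedges P']}.
  by rewrite cSS.
have [B [Dp [E1 [BSS shB disD hE1 [E1A E4A dE14 cE0]]]]] :=
  split_pieces L3 lambda_alpha Leps atomSS dSS disA wz sat.
set EA := \bigcup_(S in SS) sedges S in E1A E4A cE0.
set E4 := \bigcup_(S in B) piece_edges alpha d z S in E4A dE14 cE0.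
have EAE' : EA \subset E'.
  apply/bigcupsP => S /clSS[i [K [cl _ _]]]; exact: cluster_edges cl.
have EAatoms : EA = \bigcup_(P in A) aedges P.
  apply/setP => e; rewrite -cSS.
  apply/bigcupP/bigcupP => [[S hS /bigcupP[P PS eP]]|[P /bigcupP[S hS PS] eP]].
    by exists P => //; apply/bigcupP; exists S.
  by exists S => //; apply/bigcupP; exists P.
pose E3 := E' :\: EA.
pose E0 := EA :\: (E1 :|: E4).
(* [G0], [G1] and [G3] keep all vertices of [G]. The vertex sets of [G2] and [G4] are instead forced
   to be the unions over their collections. *)
pose span (E : {set {set T}}) := subgraph_on E (verts G).
have spanE (E : {set {set T}}) : E \subset edges G -> edges (span E) = E.
  move=> /subsetP EG; apply: edges_subgraph_on => e /EG eG.
  by rewrite (edge_card eG); split=> //; exact: edge_subset.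
have EAG := subset_trans EAE' E'G.
have E0G : E0 \subset edges G by rewrite (subset_trans (subsetDl _ _)).
have E1G : E1 \subset edges G := subset_trans E1A EAG.
have E4G : E4 \subset edges G := subset_trans E4A EAG.
have E3G : E3 \subset edges G := subset_trans (subsetDl _ _) E'G.
have E2G : E2 \subset edges G.
  by apply/bigcupsP => H /pHH[/andP[]].
have E2e S e : S \in SS -> e \in sedges S -> #|e| = 2.
  by move=> hS eS; apply/E'2/(subsetP EAE')/bigcupP; exists S.
pose V4 := \bigcup_(S in B) piece_verts alpha d z S.
pose V2 := \bigcup_(H in HH) verts H.
have cutz S : S \in SS -> cut_dense_on c1 (sedges S) (z S).
  move=> /clSS[i [K [cl iL _]]].
  exact: (cut_dense_on_level J0 alpha0 alphaM c00 zeta_gt0 zeta_le1 M_big cl (ltnW iL)).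
have zsize S : S \in SS -> alpha * d%:R <= #|z S|%:R.
  by move=> /clSS[i [K [cl _ _]]]; exact: cluster_core_size cl.
have eS S e : S \in SS -> e \in sedges S -> e \subset verts G.
  by move=> hS eS; apply/edge_subset/(subsetP EAG)/bigcupP; exists S.
have pvG S : S \in SS -> piece_verts alpha d z S \subset verts G.
  move=> hS; rewrite subUset; apply/andP; split.
    apply: (cut_dense_on_sub_verts c10 _ (cutz S hS)) => [|e]; last exact: eS.
    by rewrite -(ler_nat R) (le_trans ad2) // zsize.
  apply/subsetP => u; rewrite inE => hu.
  have : 0 < (degree (eadj (sedges S)) u (z S))%:R :> R.
    by apply: lt_le_trans hu; rewrite mulr_gt0.
  rewrite ltr0n card_gt0 => /set0Pn[y]; rewrite inE => /andP[_ /(eS S _ hS)].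
  by rewrite subUset sub1set => /andP[].
have E4r : edges (subgraph_on E4 V4) = E4.
  apply: edges_subgraph_on => e e4; split; last by apply: edge_card; exact: subsetP E4G e e4.
  have /bigcupP[S SB] := e4; rewrite inE => /andP[_ h].
  by apply: subset_trans h _; exact: bigcup_sup.
have E2r : edges (subgraph_on E2 V2) = E2.
  apply: edges_subgraph_on => e e2; split; last by apply: edge_card; exact: subsetP E2G e e2.
  have /bigcupP[H HHH eH] := e2; apply: subset_trans (edge_subset eH) _.
  exact: bigcup_sup.
exists (span E0), (span E1), (subgraph_on E2 V2), (span E3), (subgraph_on E4 V4); split.
  split.
  - rewrite /= /subgraph !spanE // E4r E2r !subxx E0G E1G E2G E3G E4G !andbT /=.
    apply/andP; split; last by apply/bigcupsP => S /(subsetP BSS)/pvG.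
    by apply/bigcupsP => H /pHH[/andP[]].
  - have d2 (F : {set {set T}}) : F \subset E' -> [disjoint F & E2].
      move=> FE; rewrite (disjointWl FE) // disjoints_subset.
      by apply/subsetP => e; rewrite !inE => /andP[].
    have d3 (F : {set {set T}}) : F \subset EA -> [disjoint F & E3].
      move=> FE; rewrite disjoint_sym (disjointWr FE) // disjoints_subset.
      by apply/subsetP => e; rewrite !inE => /andP[].
    have d0 (F : {set {set T}}) : F \subset E1 :|: E4 -> [disjoint E0 & F].
      move=> FE; rewrite (disjointWr FE) // disjoints_subset.
      by apply/subsetP => e; rewrite !inE => /andP[].
    have sub0 : E0 \subset EA := subsetDl _ _.
    rewrite /= /edge_disjoint !spanE // E4r E2r !andbT.
    have E0E' := subset_trans sub0 EAE'; have E1E' := subset_trans E1A EAE'.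
    have E4E' := subset_trans E4A EAE'; have E3E' : E3 \subset E' := subsetDl _ _.
    rewrite (d0 E1) ?subsetUl // (d0 E4) ?subsetUr // (d2 E0) // (d2 E1) //.
    rewrite (d3 E0) // (d3 E1) // dE14 (disjoint_sym (mem E2)) (d2 E3) //.
    by rewrite (disjoint_sym (mem E2)) (d2 E4) // (disjoint_sym (mem E3)) (d3 E4).
  - rewrite !big_cons big_nil !spanE // E4r E2r setU0.
    apply/eqP; rewrite eqEsubset !subUset E0G E1G E2G E3G E4G /=.
    apply/subsetP => e eG; rewrite !inE eG !andbT.
    case: (e \in E2); rewrite ?orbT //=.
    by case: (e \in E1); case: (e \in E4); rewrite ?orbT //=; case: (e \in EA).
split.
- rewrite spanE //; apply: le_trans cE0 _.
  by rewrite ler_wpM2l ?(ltW eps0) // ler_nat subset_leq_card.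
- move=> K; have hG1 e : e \in edges (span E1) -> exists S,
      [/\ S \in SS :\: B, e \subset Dp S & e :&: w S != set0].
    by rewrite spanE //; exact: hE1.
  case/(component_cover disD hG1) => S vS [S0|[S' hS' SS']].
    by exists S; rewrite // S0 cards0 mulr_ge0 // ltW.
  exists S => //; apply: le_trans (_ : #|w S'|%:R <= _).
    by rewrite ler_nat subset_leq_card.
  have {}hS' : S' \in SS by move: hS'; rewrite inE => /andP[].
  have [i [K' [cl iL _]]] := clSS S' hS'.
  apply: ltW; exact: (cluster_cover d_gt0 J0 alpha0 alphaM c00 zeta_gt0 zeta_le1
    M_big rho_small core_free cl (ltnW iL)).
- exists HH; last by move=> H /pHH[].
  by split=> //; rewrite ?E2r.
- move=> [S [_ cS eS3]].
  (* A dense set in [E3] would contain an atom edge-disjoint from the whole maximal family. *)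
  have [P [aP PE]] : exists P : atom T, is_atom J alpha theta L d P /\ aedges P \subset E3.
    apply: (hA d ddA T E3 S) => //; first by move=> e /(subsetP E3G)/edge_card.
    apply: le_trans eS3 _; rewrite ler_nat /npairs.
    apply: leq_trans (leq_imset_card (fun p : T * T => [set p.1; p.2]) _).
    apply/subset_leq_card/subsetP => e; rewrite inE spanE // => /andP[e3 eS'].
    have /eqP/cards2P[x [y [_ exy]]] := edge_card (subsetP E3G e e3).
    apply/imsetP; exists (x, y); rewrite // inE in_setX /= /eadj -exy e3 andbT.
    by move: eS'; rewrite exy subUset !sub1set.
  have : aedges P = set0 by apply: mAt aP _; rewrite -EAatoms.
  move=> P0; have := aedges_size aP; rewrite P0 cards0 leqn0 !muln_eq0.
  have [[_ [_ X0] _ _ _] hw _ _] := aP.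
  rewrite !gtn_eqF //; first by rewrite -(ltr0n R) (lt_le_trans _ hw) // mulr_gt0.
  exact: leq_trans L3.
- have ovB S (B' : {set {set atom T}}) : S \in B -> B' \subset B ->
      (forall S', S' \in B' -> gamma0 * d%:R <
        #|piece_verts alpha d z S :&: piece_verts alpha d z S'|%:R) ->
      (#|B'|)%:R <= 1 / lambda.
    move=> SB B'B big; apply: le_trans Lc_lambda; rewrite ler_nat ltnW //.
    have [i [K [cl iL _]]] := clSS S (subsetP BSS S SB).
    have B'SS S' : S' \in B' -> S' \in SS by move=> /(subsetP B'B)/(subsetP BSS).
    apply: (few_large_overlaps d_gt0 L3 J0 alpha0 alphaM c00 c01 zeta_gt0 zeta_le1
      M_big Lc_big Lc_zeta extraction core_free gamma_gt0 gamma_le1 cl iL (lexx _) (z:=z)).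
    + by move=> S' /B'SS/clSS[i' [K' [cl' iL' _]]]; exists i', (w S'), K'.
    + move=> S' /big; apply: le_lt_trans; rewrite ler_wpM2r ?(ltW D0) //.
      by rewrite ge_min lexx.
    + move=> S1 S2 /B'SS h1 /B'SS h2 ne; apply: le_trans (ovSS S1 S2 h1 h2 ne).
      by rewrite ler_nat subset_leq_card // setISS ?subsetUl.
  apply: (pieces_well_connected d_gt0 L3 alpha0 atomSS dSS disA BSS) => //.
  + by rewrite ge_min lexx orbT.
  + move=> S hS; apply: cut_dense_onW (subxx _) (cutz S hS); by rewrite ge_min lexx.
  + by move=> S /clSS[i [K [[[_ h _] _ _ _ _] _ _]]].
  + move=> S S' hS hS' ne; apply: le_trans (ovSS S S' hS hS' ne) _.
    by rewrite ler_wpM2r ?(ltW D0) // ge_min lexx.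
Qed.
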